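(* Let $\ell$ be prime and let $N_{\ell}:=(\ell^6-2\ell^5+2\ell^4-3\ell^2+2\ell)/24$. If $n>N_\ell$ and $\lambda,\mu$ are partitions of $n$ that are both $\ell$-core partitions, then $\chi_\lambda(\mu)=0$.
   Context: For partitions $\lambda,\mu$ of $n$, $\chi_\lambda(\mu)$ denotes the value of the irreducible character of $S_n$ indexed by $\lambda$ on the conjugacy class of cycle type $\mu$. The hook length of the cell $(k,j)$ in the Young diagram of $\lambda$ is $h_\lambda(k,j)=(\lambda_k-k)+(\lambda'_j-j)+1$, where $\lambda'_j$ is the number of cells in column $j$; $\lambda$ is an $\ell$-core if none of its hook lengths is a multiple of $\ell$. *)

(* Defs.v *)
From HB Require Import structures.
From mathcomp Require Import all_boot all_order all_algebra all_fingroup.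
From mathcomp Require Import all_solvable all_field all_character.

Set Implicit Arguments.
Unset Strict Implicit.
Unset Printing Implicit Defensive.

Import GRing.Theory Num.Theory.

Local Open Scope nat_scope.

Definition is_partition (n : nat) (la : seq nat) : bool :=
  [&& sorted geq la, 0 \notin la & sumn la == n].

(* Rows, columns and cells are numbered from 0: cell (k, j) belongs to the
   Young diagram when k < size la and j < nth 0 la k. *)
Definition column_length (la : seq nat) (j : nat) : nat :=
  count (fun part => j < part) la.

(* With 0-based k and j, the hook length (la_k - k) + (la'_j - j) + 1 reads
   la_k + la'_j - (k + j + 1). On a cell of the diagram la_k > j and la'_j > k,
   so the subtraction does not truncate. *)
Definition hook_length (la : seq nat) (k j : nat) : nat :=
  nth 0 la k + column_length la j - (k + j).+1.

Definition is_core (l : nat) (la : seq nat) : Prop :=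
  forall k j : nat, k < size la -> j < nth 0 la k ->
    ~~ (l %| hook_length la k j).

Definition cycle_type (n : nat) (g : 'S_n) : seq nat :=
  sort geq [seq #|pred_of_set X| | X <- enum (porbits g)].

(* The tableau of shape la filled with 0, ..., n - 1 in reading order has
   i in row reshape_index la i and column reshape_offset la i. *)
Definition row_stabilizer (n : nat) (la : seq nat) : {set 'S_n} :=
  [set p : 'S_n | [forall i, reshape_index la (p i) == reshape_index la i]].

Definition column_stabilizer (n : nat) (la : seq nat) : {set 'S_n} :=
  [set q : 'S_n | [forall i, reshape_offset la (q i) == reshape_offset la i]].

Local Open Scope ring_scope.

(* The Young symmetrizer \sum_(p, q) sgn(q) p q of the group algebra, in
   coordinates for the basis of group elements used by regular_repr. *)
Definition young_symmetrizer (n : nat) (la : seq nat) :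
    'rV[algC]_#|[set: 'S_n]| :=
  \sum_(p in row_stabilizer n la) \sum_(q in column_stabilizer n la)
    (-1) ^+ q *: delta_mx 0 (gring_index [set: 'S_n]%G (p * q)%g).

(* The irreducible character indexed by la: the character of the Specht module,
   realized as the right ideal of the group algebra over algC generated by the
   Young symmetrizer. The one-row partition gives the trivial character. *)
Definition specht_char (n : nat) (la : seq nat) : 'CF([set: 'S_n]) :=
  cfRepr (submod_repr
    (cyclic_mx_module (regular_repr algC [set: 'S_n]%G)
       (young_symmetrizer n la))).

Definition core_bound (l : nat) : rat :=
  (l%:R ^+ 6 - 2 * l%:R ^+ 5 + 2 * l%:R ^+ 4 - 3 * l%:R ^+ 2 + 2 * l%:R) / 24.

(* Main.v *)
Require Import Defs.
From HB Require Import structures.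
From mathcomp Require Import all_boot all_order all_algebra all_fingroup.
From mathcomp Require Import all_solvable all_field all_character.
From mathcomp Require Import zify ring lra.

(* Write c = a b for the Young symmetrizer of la, a being the sum over the row
   group and b the signed sum over the column group. Peeling off the first row
   of the diagram shows c ^ 2 = H c with H the product of the hook lengths. If
   la is an l-core then l does not divide H, so c / H is an idempotent with
   l-integral coefficients, and the character of its right ideal vanishes at
   every g of order divisible by l: for N = l ^ m, the coefficient sum of
   c ^ N = H ^ (N - 1) c over the class of g is a sum over words of length N,
   and grouping words by cyclic rotation makes it divisible by arbitrarily high
   powers of l, since a word with few rotations has a product of order prime
   to l.

   It remains to see that an l-core mu of size n > N_l has a part divisible by
   l. On the l-runner abacus of mu, let p_s be the first gap of runner s. Along
   a runner, consecutive beads give parts differing by the number i of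
   exhausted runners; as 0 < i < l, a run of l such beads yields a part
   divisible by l. Hence consecutive values of the sorted p_s are less than
   l ^ 2 - l apart, up to one initial jump, and n is, up to normalization, the
   variance of the p_s. *)

Set Implicit Arguments.
Unset Strict Implicit.
Unset Printing Implicit Defensive.

Import Order.TTheory GRing.Theory Num.Theory.

Local Open Scope ring_scope.

(** * Square of the Young symmetrizer *)

Section SymmetrizerSums.

Variables (T : finType) (A : pzRingType) (rho : {perm T} -> A).
Hypothesis rho1 : rho 1%g = 1.
Hypothesis rhoM : forall s t : {perm T}, rho (s * t)%g = rho s * rho t.

Implicit Types (f : T -> nat) (D : {set T}) (e : bool) (p q : {perm T}).

(** With [f] the row map, the column map or a constant, this is the row group, the column group or
    the full symmetric group of [D]. *)
Definition fiber_stab f D : {set {perm T}} :=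
  [set p | perm_on D p && [forall x, f (p x) == f x]].

Definition stab_sum e f D : A :=
  \sum_(p in fiber_stab f D) (-1) ^+ (e && odd_perm p) * rho p.

Lemma fiber_stabP f D p :
  reflect (perm_on D p /\ forall x, f (p x) = f x) (p \in fiber_stab f D).
Proof.
rewrite inE; apply: (iffP andP) => -[Dp].
  by move/forallP=> fp; split=> // x; apply/eqP.
by move=> fp; split=> //; apply/forallP=> x; rewrite fp.
Qed.

Lemma fiber_stabM f D p q :
  p \in fiber_stab f D -> q \in fiber_stab f D -> (p * q)%g \in fiber_stab f D.
Proof.
move=> /fiber_stabP[Dp fp] /fiber_stabP[Dq fq].
by apply/fiber_stabP; split=> [|x]; rewrite ?perm_onM // permM fq.
Qed.

Lemma fiber_stabV f D p : p \in fiber_stab f D -> p^-1%g \in fiber_stab f D.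
Proof.
move=> /fiber_stabP[Dp fp]; apply/fiber_stabP; split=> [|x].
  exact: perm_onV.
by rewrite -{2}(permKV p x) fp.
Qed.

Lemma fiber_stabS f D D' :
  D \subset D' -> {subset fiber_stab f D <= fiber_stab f D'}.
Proof.
move=> sDD' p /fiber_stabP[Dp fp]; apply/fiber_stabP; split=> //.
exact: subset_trans Dp sDD'.
Qed.

Lemma tperm_fiber_stab f D x y :
  x \in D -> y \in D -> f x = f y -> tperm x y \in fiber_stab f D.
Proof.
move=> Dx Dy fxy; apply/fiber_stabP; split=> [|z].
  by apply/subsetP=> z; rewrite inE; case: tpermP => [->|->|]; rewrite ?eqxx.
by case: tpermP => [->|->|].
Qed.

Lemma mul_signCA (x y : A) (n : nat) :
  x * ((-1) ^+ n * y) = (-1) ^+ n * (x * y).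
Proof. by rewrite mulrA (commr_sign x n) -mulrA. Qed.

Lemma stab_sum_mull e f D t : t \in fiber_stab f D ->
  rho t * stab_sum e f D = (-1) ^+ (e && odd_perm t) * stab_sum e f D.
Proof.
move=> Dt; rewrite /stab_sum !mulr_sumr.
rewrite [RHS](reindex_inj (mulgI t)) /=; apply: eq_big => [p|p Dp].
  apply/idP/idP => Dp; first exact: fiber_stabM.
  by rewrite -(mulKg t p) fiber_stabM ?fiber_stabV.
rewrite rhoM mul_signCA odd_permM.
case: e => /=; rewrite ?expr0 ?mul1r // [RHS]mulrA -signr_addb.
by rewrite addbA addbb.
Qed.

Lemma stab_sum_mulr e f D t : t \in fiber_stab f D ->
  stab_sum e f D * rho t = (-1) ^+ (e && odd_perm t) * stab_sum e f D.
Proof.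
move=> Dt; rewrite /stab_sum mulr_suml mulr_sumr.
rewrite [RHS](reindex_inj (mulIg t)) /=; apply: eq_big => [p|p Dp].
  apply/idP/idP => Dp; first exact: fiber_stabM.
  by rewrite -(mulgK t p) fiber_stabM ?fiber_stabV.
rewrite rhoM odd_permM.
case: e => /=; rewrite ?expr0 ?mul1r // [RHS]mulrA -signr_addb.
by rewrite addbCA addbb addbF mulrA.
Qed.

(** Cosets of the stabilizer of [u]: a permutation sending [w] to [u] is [tperm u w] times one that
    fixes [u], and [w = u] contributes the summand 1. *)
Lemma stab_sum_cosetl e f D u : u \notin D ->
  stab_sum e f (u |: D) =
  (1 + (-1) ^+ e * \sum_(w in D | f w == f u) rho (tperm u w))
    * stab_sum e f D.
Proof.
move=> uD; rewrite /stab_sum.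
rewrite (partition_big (fun p : {perm T} => (p^-1%g) u)
  (fun w => (w \in u |: D) && (f w == f u))) /=; last first.
  move=> p /fiber_stabV/fiber_stabP[Dp ->]; rewrite eqxx andbT.
  by rewrite (perm_closed _ Dp) setU11.
pose F w := (-1) ^+ (e && (u != w)) * rho (tperm u w) * stab_sum e f D.
rewrite (eq_bigr F) => [|w /andP[uDw fwu]]; last first.
  rewrite /F /stab_sum mulr_sumr (reindex_inj (mulgI (tperm u w))) /=.
  apply: eq_big => [p|p _].
    apply/andP/idP=> [[/fiber_stabP[Dp fp] /eqP pu]|/fiber_stabP[Dp fp]].
      have pu1 : p u = u.
        by rewrite -{2}(permKV (tperm u w * p) u) pu permM tpermR.
      apply/fiber_stabP; split=> [|x].
        apply/subsetP=> x; rewrite inE => px.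
        have [xu|xu] := eqVneq x u; first by rewrite xu pu1 eqxx in px.
        have [xw|xw] := eqVneq x w.
          by move: uDw xu; rewrite xw !inE => /orP[->|].
        have tx : tperm u w x = x by rewrite tpermD // eq_sym.
        have := subsetP Dp x; rewrite !inE permM tx.
        by move=> /(_ px); rewrite (negPf xu).
      have := fp (tperm u w x); rewrite permM tpermK => ->.
      by case: tpermP => [->|->|] //; apply/eqP; rewrite // eq_sym.
    split.
      apply: fiber_stabM.
        by apply: tperm_fiber_stab; rewrite ?setU11 //; apply/esym/eqP.
      by apply/(fiber_stabS (subsetUr _ _))/fiber_stabP.
    apply/eqP/(perm_inj (s := (tperm u w * p)%g)); rewrite permKV permM tpermR.
    by rewrite (out_perm Dp uD).
  rewrite rhoM odd_permM odd_tperm -mulrA mul_signCA [RHS]mulrA -signr_addb.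
  by case: (e).
rewrite -mulr_suml; congr (_ * _).
rewrite (bigD1 u) /=; last by rewrite setU11 eqxx.
rewrite eqxx andbF expr0 mul1r tperm1 rho1 mulr_sumr; congr (1 + _).
apply: eq_big => [w|w /andP[_ wu]]; last by rewrite eq_sym wu andbT.
rewrite !inE; have [->|] := eqVneq w u; last by rewrite andbT.
by rewrite (negPf uD) andbF.
Qed.

Lemma stab_sum_comm_perm e f D (t : {perm T}) :
  (forall x, x \in D -> t x = x) ->
  rho t * stab_sum e f D = stab_sum e f D * rho t.
Proof.
move=> tD; rewrite mulr_sumr mulr_suml; apply: eq_bigr => p /fiber_stabP[Dp _].
rewrite mul_signCA -mulrA -!rhoM; congr (_ * rho _).
apply: (@perm_onC _ (~: D) D) => //.
  by apply/subsetP=> x; rewrite !inE; apply: contra => /tD->.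
by rewrite disjoint_sym disjoints_subset setCK.
Qed.

Lemma stab_sum_comm e e' f f' D D' : [disjoint D & D'] ->
  stab_sum e f D * stab_sum e' f' D' = stab_sum e' f' D' * stab_sum e f D.
Proof.
move=> dD; rewrite /(stab_sum e' f' D') mulr_sumr mulr_suml.
apply: eq_bigr => p /fiber_stabP[Dp _].
rewrite mul_signCA -mulrA; congr (_ * _); apply/esym/stab_sum_comm_perm=> x xD.
by apply: (out_perm Dp); rewrite (disjointFr dD).
Qed.

Lemma stab_sum0 e f : stab_sum e f set0 = 1.
Proof.
rewrite /stab_sum (big_pred1 1%g) ?odd_perm1 ?andbF ?mul1r // => p /=.
apply/fiber_stabP/eqP => [[p0 _]|->]; last by split=> [|x];
  rewrite ?perm_on1 ?perm1.
by apply/permP=> x; rewrite perm1 (out_perm p0) ?inE.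
Qed.

(** Induction on [#|D|], splitting off one point [u] of [D]: no point of [D'] shares a fiber with
    [u], so the transposition factor is the same with and without [D']. *)
Lemma stab_sumU e f D D' : [disjoint D & D'] ->
  (forall x y, x \in D -> y \in D' -> f x != f y) ->
  stab_sum e f (D :|: D') = stab_sum e f D * stab_sum e f D'.
Proof.
move: {2}#|D| (leqnn #|D|) => n; elim: n D => [|n IHn] D.
  by rewrite leqn0 cards_eq0 => /eqP-> _ _; rewrite set0U stab_sum0 mul1r.
move=> leDn dD fD; have [->|[u uD]] := set_0Vmem D.
  by rewrite set0U stab_sum0 mul1r.
have sD1 := subD1set D u;
  have dD1 : [disjoint D :\ u & D'] by apply: disjointWl dD.
rewrite -(setD1K uD) -setUA !stab_sum_cosetl ?inE ?eqxx //=; last first.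
  by rewrite (disjointFr dD uD).
rewrite IHn //; first last.
- by move=> x y /(subsetP sD1); apply: fD.
- by move: leDn; rewrite (cardsD1 u) uD.
rewrite mulrA; congr ((1 + _ * _) * _ * _); apply: eq_bigl => w; rewrite !inE.
have [wD'|] := boolP (w \in D'); last by rewrite orbF.
by rewrite orbT (disjointFl dD wD') andbF /= eq_sym (negPf (fD _ _ uD wD')).
Qed.

Lemma stab_sum_sub_mull e f D D' : D \subset D' ->
  stab_sum e f D * stab_sum e f D' = stab_sum e f D' *+ #|fiber_stab f D|.
Proof.
move=> sD; rewrite {1}/stab_sum mulr_suml -sumr_const; apply: eq_bigr => p Dp.
rewrite -mulrA stab_sum_mull ?(fiber_stabS sD) //.
by rewrite mulrA -signr_addb addbb mul1r.
Qed.

Lemma stab_sumM e e' f f' D D' z :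
  stab_sum e f D * stab_sum e' f' D' * z =
  \sum_(q in fiber_stab f D) \sum_(p in fiber_stab f' D')
    (-1) ^+ (e && odd_perm q) * ((-1) ^+ (e' && odd_perm p) * (rho (q * p)%g *
      z)).
Proof.
rewrite {1}/stab_sum !mulr_suml; apply: eq_bigr => q _.
rewrite /stab_sum mulr_sumr mulr_suml; apply: eq_bigr => p _.
by rewrite mul_signCA !mulrA rhoM -!mulrA mul_signCA.
Qed.

End SymmetrizerSums.

(** Inversion reverses products, so [rho'] is multiplicative into the converse ring [A^c], and the
    left coset formula there is the right one in [A]. *)
Lemma stab_sum_cosetr (T : finType) (A : pzRingType) (rho : {perm T} -> A)
    (e : bool) (f : T -> nat) (D : {set T}) (u : T) :
  rho 1%g = 1 -> (forall s t : {perm T}, rho (s * t)%g = rho s * rho t) ->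
  u \notin D ->
  stab_sum rho e f (u |: D) = stab_sum rho e f D
    * (1 + (-1) ^+ e * \sum_(w in D | f w == f u) rho (tperm u w)).
Proof.
move=> rho1 rhoM uD; pose rho' (p : {perm T}) : A^c := rho p^-1%g.
have stabE E : stab_sum rho' e f E = stab_sum rho e f E :> A.
  rewrite /stab_sum (reindex_inj invg_inj) /=; apply: eq_big => [p|p _].
    by apply/idP/idP => /fiber_stabV; rewrite ?invgK.
  rewrite /rho' invgK odd_permV.
  by case: (e && _); rewrite ?expr0 ?expr1 ?mul1r // [RHS]mulN1r; apply: mulrN1.
have rho1' : rho' 1%g = 1 by rewrite /rho' invg1 rho1.
have rhoM' s t : rho' (s * t)%g = rho' s * rho' t by rewrite /rho' invMg rhoM.
rewrite -!stabE (stab_sum_cosetl rho1' rhoM' e f uD).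
set x := (\sum_(w in D | _) _ : A^c); set y := (\sum_(w in D | _) _ : A).
have -> : x = y :> A by apply: eq_bigr => w _; rewrite /rho' tpermV.
have -> : ((-1 : A^c) ^+ e : A) = (-1) ^+ e by case: (e).
congr (_ * (1 + _)); exact: commr_sign.
Qed.

Section YoungSquare.

Variables (T : finType) (row col : T -> nat).
Hypothesis cell_inj : forall x y, row x = row y -> col x = col y -> x = y.
Hypothesis cell_down : forall x r c, (r <= row x)%N -> (c <= col x)%N ->
  exists2 y, row y = r & col y = c.

Definition arm (x : T) : nat :=
  #|[set y | (row y == row x) && (col x < col y)%N]|.
Definition leg (x : T) : nat :=
  #|[set y | (col y == col x) && (row x < row y)%N]|.
Definition cell_hook (x : T) : nat := (arm x + leg x).+1.

Definition rows_from (r : nat) : {set T} := [set x | (r <= row x)%N].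

Variables (A : pzRingType) (rho : {perm T} -> A).
Hypothesis rho1 : rho 1%g = 1.
Hypothesis rhoM : forall s t : {perm T}, rho (s * t)%g = rho s * rho t.
Hypothesis torsion_free : forall (x : A) (n : nat), x *+ n.+1 = 0 -> x = 0.

(** The Young symmetrizer of the diagram without its first [r] rows, so that rows can be removed by
    induction. *)
Definition young_elt (r : nat) : A :=
  stab_sum rho false row (rows_from r) * stab_sum rho true col (rows_from r).

Lemma mulrn_inj_tf (x y : A) (n : nat) : (0 < n)%N -> x *+ n = y *+ n -> x = y.
Proof.
case: n => // n _ /eqP; rewrite -subr_eq0 -mulrnBl => /eqP/torsion_free/eqP.
by rewrite subr_eq0 => /eqP.
Qed.

Lemma eq_opp_tf (x : A) : x = - x -> x = 0.
Proof.
by move=> xN; apply: (@torsion_free x 1); rewrite mulr2n {1}xN addNr.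
Qed.

(** * Splitting off the first row of a diagram *)

Section FirstRow.

Variable r : nat.

Let D := rows_from r.
Let row_set : {set T} := [set x | row x == r].
Let a := stab_sum rho false row D.
Let b := stab_sum rho true col D.

(** These sets interpolate between [rows_from r.+1] at [s = 0] and [rows_from r] for large [s], one
    cell of row [r] at a time. *)
Definition rows_upto (s : nat) : {set T} :=
  [set x | (r < row x)%N || (row x == r) && (col x < s)%N].

Let y s := stab_sum rho true col (rows_upto s) * a * b.

Lemma rows_upto_sub s : rows_upto s \subset D.
Proof.
by apply/subsetP=> x; rewrite !inE => /orP[/ltnW//|/andP[/eqP-> _]].
Qed.

Lemma row_set_sub : row_set \subset D.
Proof. by apply/subsetP=> x; rewrite !inE => /eqP->. Qed.

(* The first row is the longest one, so one more point forces two points into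
   a common column. *)
Lemma sym_antisym_eq0 (w : T) (g : {perm T}) :
  w \in D -> w \notin row_set -> perm_on D g ->
  stab_sum rho false (fun=> 0) (w |: row_set) * (rho g * b) = 0.
Proof.
move=> Dw wr Dg; set U := w |: row_set.
have sUD : U \subset D by rewrite subUset sub1set Dw row_set_sub.
have [x [x' [xU x'U neq_xx' colx]]] :
    exists x x', [/\ x \in U, x' \in U, x != x' & col (g x) = col (g x')].
  pose h x := odflt w [pick z | (row z == r) && (col z == col (g x))].
  have hP x : x \in U -> row (h x) = r /\ col (h x) = col (g x).
    move=> /(subsetP sUD) Dx; rewrite /h;
      case: pickP => [z /andP[/eqP-> /eqP->]//|].
    have [z rz cz] : exists2 z, row z = r & col z = col (g x).
      apply: (@cell_down (g x)) => //.
      by have := perm_closed x Dg; rewrite Dx inE.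
    by move=> /(_ z); rewrite rz cz !eqxx.
  have : ~~ dinjectiveb h (mem U).
    apply/negP=> /dinjectiveP h_inj.
    have : (#|h @: U| <= #|row_set|)%N.
      apply/subset_leq_card/subsetP=> z /imsetP[x /hP[hx _] ->].
      by rewrite inE hx.
    by rewrite card_in_imset // cardsU1 wr ltnn.
  case/dinjectivePn => x xU [x' /andP[neq x'U] hx].
  exists x, x'; split=> //; first by rewrite eq_sym.
  by have [_ <-] := hP x xU; have [_ <-] := hP x' x'U; rewrite hx.
(* The symmetric sum absorbs the transposition of [x] and [x'] with sign +. Moved past [rho g], it
   exchanges two cells of one column, and [b] absorbs it with sign -. *)
apply: eq_opp_tf.
have tU : tperm x x' \in fiber_stab (fun=> 0) U by apply: tperm_fiber_stab.
rewrite -[stab_sum _ _ _ _ in LHS]mul1r -[1]/((-1) ^+ (false && odd_perm (tperm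
  x x'))).
rewrite -(stab_sum_mulr rhoM false tU) -mulrA [_ * (rho g * b)]mulrA -rhoM.
rewrite conjgC tpermJ rhoM -[rho g * _ * b]mulrA.
rewrite (stab_sum_mull rhoM) ?odd_tperm /=; last first.
  by apply: tperm_fiber_stab => //; rewrite (perm_closed _ Dg) (subsetP sUD).
by rewrite (inj_eq perm_inj) neq_xx' expr1 mulN1r !mulrN.
Qed.

(** The symmetric sum over [w |: row_set] kills [y s], by [sym_antisym_eq0]. It factors as the
    symmetric sum over [row_set] times 1 plus the transpositions with [w], and [a] absorbs the first
    factor up to a positive integer. *)
Lemma sum_tperm_first_row s (w : T) : w \in D -> w \notin row_set ->
  \sum_(j in row_set) a * (rho (tperm j w) * y s) = - (a * y s).
Proof.
move=> Dw wr.
have ay : a * (stab_sum rho false (fun=> 0) (w |: row_set) * y s) = 0.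
  rewrite /y (stab_sumM rhoM) mulr_sumr big1 ?mulr0 // => q /fiber_stabP[Dq _].
  rewrite mulr_sumr big1 // => p /fiber_stabP[Dp _];
    rewrite expr0 mul1r mul_signCA.
  rewrite sym_antisym_eq0 ?mulr0 // perm_onM //.
  exact: subset_trans Dq (rows_upto_sub _).
move: ay; rewrite (stab_sum_cosetr _ _ rho1 rhoM wr) expr0 mul1r -mulrA mulrA.
have -> : a * stab_sum rho false (fun=> 0) row_set
            = a *+ #|fiber_stab (fun=> 0) row_set|.
  rewrite {1}/stab_sum mulr_sumr -sumr_const; apply: eq_bigr => p.
  case/fiber_stabP=> rp _; rewrite expr0 mul1r (stab_sum_mulr rhoM) ?mul1r //.
  apply/fiber_stabP; split=> [|x]; first exact: subset_trans rp row_set_sub.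
  have [xr|xr] := boolP (x \in row_set); last by rewrite (out_perm rp).
  have := perm_closed x rp; rewrite xr; move: xr; rewrite !inE.
  by move=> /eqP-> /eqP->.
rewrite mulrnAl; case n0 : #|_| => [|n].
  move/eqP: n0; rewrite cards_eq0 => /eqP n0; have := in_set0 (1%g : {perm T}).
  by rewrite -n0 => /fiber_stabP[]; split; rewrite ?perm_on1.
move=> /torsion_free /eqP;
  rewrite mulrDl mul1r mulrDr addrC addr_eq0 => /eqP <-.
rewrite [X in a * X]mulr_suml [RHS]mulr_sumr; apply: eq_big => [j|j _];
  first by rewrite eqxx andbT.
by rewrite tpermC.
Qed.

(** [tperm u j] conjugates [tperm u w] into [tperm j w]. On the left it is absorbed by [a]; on the
    right it commutes with the column sum of [y s], as [u] and [j] lie outside [rows_upto s], and is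
    absorbed by the [a] that follows. *)
Lemma tperm_tail_absorb s (u j w : T) :
  row u = r -> row j = r -> (s <= col u)%N -> (s <= col j)%N -> (r < row w)%N ->
  a * (rho (tperm j w) * y s) = a * (rho (tperm u w) * y s).
Proof.
move=> ur jr su sj rw; have [->//|neq_ju] := eqVneq j u.
have Dt : tperm u j \in fiber_stab row D.
  by apply: tperm_fiber_stab; rewrite ?inE ?ur ?jr.
have ty : rho (tperm u j) * y s = y s.
  rewrite /y !mulrA (stab_sum_comm_perm rhoM) => [|x].
    by rewrite -[_ * rho _ * a]mulrA (stab_sum_mull rhoM _ Dt) mul1r.
  rewrite inE => xs; apply: tpermD; apply: contraTneq xs => <-.
    by rewrite ur ltnn eqxx -leqNgt.
  by rewrite jr ltnn eqxx -leqNgt.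
have -> : tperm j w = (tperm u j * (tperm u w * tperm u j))%g.
  rewrite -[tperm u j in X in (X * _)%g]tpermV -[LHS]/(tperm j w).
  rewrite -/(conjg (tperm u w) (tperm u j)) tpermJ tpermL tpermD //.
    by apply: contraTneq rw => <-; rewrite ur ltnn.
  by apply: contraTneq rw => <-; rewrite jr ltnn.
rewrite !rhoM -!mulrA ty mulrA (stab_sum_mulr rhoM _ Dt) mul1r //.
Qed.

(** Let [z] be the cell in the row of [w] and the column of [j]. Then [tperm w z], absorbed by [a],
    passes through [tperm j w] as [tperm j z], which the column sum absorbs with a minus sign; so
    the product equals its opposite. *)
Lemma tperm_head_eq0 s (j w : T) :
  row j = r -> (col j < s)%N -> (col j < col w)%N -> (r < row w)%N ->
  a * (rho (tperm j w) * y s) = 0.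
Proof.
move=> jr js jw rw.
have [z rz cz] : exists2 z, row z = row w & col z = col j.
  by apply: (@cell_down w); rewrite // ltnW.
have Dwz : tperm w z \in fiber_stab row D.
  by apply: tperm_fiber_stab; rewrite ?inE ?rz // ltnW.
have neq_jw : j != w by apply: contraTneq jw => ->; rewrite ltnn.
have neq_jz : j != z by apply: contraTneq rw => jz; rewrite -rz -jz jr ltnn.
have neq_wz : w != z by apply: contraTneq jw => ->; rewrite cz ltnn.
have Djz : tperm j z \in fiber_stab col (rows_upto s).
  apply: tperm_fiber_stab; rewrite ?inE ?jr ?js ?rz ?rw ?eqxx ?orbT //.
apply: eq_opp_tf; rewrite -[a in LHS]mul1r.
rewrite -[1]/((-1) ^+ (false && odd_perm (tperm w z))).
rewrite -(stab_sum_mulr rhoM false Dwz) -/a -mulrA [_ * (rho _ * y s)]mulrA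
  -rhoM.
have -> : (tperm w z * tperm j w)%g = (tperm j w * tperm j z)%g.
  by rewrite conjgC tpermJ tpermR tpermD.
rewrite rhoM -!mulrA /y.
rewrite [rho (tperm j z) * _]mulrA [rho (tperm j z) * _]mulrA.
rewrite (stab_sum_mull rhoM _ Djz) odd_tperm neq_jz expr1 mulN1r !mulNr.
by rewrite !mulrN.
Qed.

(** Adding [u] to the column sum subtracts a term with [tperm u w] for each [w] in the leg of [u].
    In [sum_tperm_first_row] the cells left of [u] contribute 0 and the [(arm u).+1] others
    contribute equally, so each leg cell adds one more [a * y s]. *)
Lemma hook_step (u : T) : row u = r ->
  (a * y (col u).+1) *+ (arm u).+1 = (a * y (col u)) *+ cell_hook u.
Proof.
move=> ur; set s := col u.
have us : u \notin rows_upto s by rewrite inE ur ltnn eqxx ltnn.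
have -> : y s.+1 = y s
    - \sum_(w in [set w | (col w == col u) && (row u < row w)%N])
        rho (tperm u w) * y s.
  have Us : rows_upto s.+1 = u |: rows_upto s.
    apply/setP=> x; rewrite !inE ltnS (leq_eqVlt (col x));
      have [->|xu] := eqVneq x u.
      by rewrite ur !eqxx orbT.
    have [xr|] //= := eqVneq (row x) r; have [xs|] //= := eqVneq (col x) s.
    by rewrite (cell_inj (x := x) (y := u)) ?eqxx ?xr in xu.
  have -> : y s.+1 =
      (1 - \sum_(w in rows_upto s | col w == col u) rho (tperm u w)) * y s.
    by rewrite /y Us (stab_sum_cosetl rho1 rhoM _ _ us) expr1 mulN1r !mulrA.
  rewrite mulrBl mul1r; congr (_ - _); rewrite [LHS]mulr_suml.
  apply: eq_bigl => w; rewrite !inE ur -/s; have [->|] := eqVneq (col w) s.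
    by rewrite ltnn andbF orbF andbT.
  by rewrite andbF.
rewrite mulrBr mulrnBl mulr_sumr -sumrMnl.
have tw w : w \in [set w | (col w == col u) && (row u < row w)%N] ->
    a * (rho (tperm u w) * y s) *+ (arm u).+1 = - (a * y s).
  rewrite inE ur => /andP[/eqP cw rw].
  have Dw : w \in D by rewrite inE ltnW.
  have wr : w \notin row_set by rewrite inE neq_ltn rw orbT.
  rewrite -(sum_tperm_first_row s Dw wr) (bigID (fun j => (s <= col j)%N)) /=.
  rewrite [X in _ + X]big1 ?addr0 => [|j]; last first.
    rewrite inE -ltnNge => /andP[/eqP jr js].
    by apply: tperm_head_eq0; rewrite // cw.
  rewrite (eq_bigr (fun=> a * (rho (tperm u w) * y s))) => [|j]; last first.
    by rewrite inE => /andP[/eqP jr sj]; apply: tperm_tail_absorb.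
  rewrite big_const -/(\sum_(j | _) _) iter_addr_0; congr (_ *+ _).
  rewrite -[(arm u).+1]/(1 + arm u)%N.
  have -> : 1%N = (u \notin [set j | (row j == row u) && (col u < col j)%N]).
    by rewrite inE ltnn andbF.
  rewrite -cardsU1; apply: eq_card => j.
  rewrite [RHS]unfold_in !inE ur (leq_eqVlt s) (eq_sym s) -/s.
  have [->|ju] := eqVneq j u; first by rewrite ur !eqxx.
  have [jr|] //= := eqVneq (row j) r; have [js|] //= := eqVneq (col j) s.
  by rewrite (cell_inj (x := j) (y := u)) ?eqxx ?jr in ju.
rewrite (eq_bigr _ tw) sumr_const -/(leg u) mulNrn opprK -mulrnDr.
by rewrite /cell_hook addSn.
Qed.

(** [hook_step] is iterated along row [r]. The factors [(arm u).+1] run through 1, ...,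
    [#|row_set|], whence the factorial. *)
Lemma first_row_square :
  (a * b * (a * b)) *+ #|row_set|`! =
  (a * (stab_sum rho true col (rows_from r.+1) * a * b))
    *+ \prod_(u in row_set) cell_hook u.
Proof.
have y0 : rows_upto 0 = rows_from r.+1.
  by apply/setP=> x; rewrite !inE ltn0 andbF orbF.
pose E s : {set T} := [set x | (row x == r) && (s <= col x)%N].
(* The factorial of [#|E s|] collects the values [(arm u).+1] of the columns not yet treated. *)
have main s : (a * y s) *+ #|row_set|`! =
    (a * y 0) *+ ((\prod_(u in row_set | (col u < s)%N) cell_hook u) * #|E
      s|`!).
  elim: s => [|s IHs].
    rewrite big_pred0 ?mul1n => [|u]; last by rewrite ltn0 andbF.
    congr (_ *+ _`!); apply: eq_card => x; by rewrite !inE andbT.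
  case: (pickP [pred u | (row u == r) && (col u == s)]) => [u|noU]; last first.
    have neq_s x : row x == r -> (col x == s) = false.
      by move=> xr; have := noU x; rewrite /= xr.
    have -> : y s.+1 = y s.
      congr (stab_sum _ _ _ _ * _ * _); apply/setP=> x;
        rewrite !inE ltnS (leq_eqVlt (col x)).
      by case: (row x =P r) => //= /eqP/neq_s->.
    rewrite IHs; congr (_ *+ (_ * _`!)).
      apply: eq_bigl => x; rewrite !inE ltnS (leq_eqVlt (col x)).
      by case: (row x =P r) => //= /eqP/neq_s->.
    apply: eq_card => x; rewrite !inE (leq_eqVlt s) (eq_sym s).
    by case: (row x =P r) => //= /eqP/neq_s->.
  move=> /= /andP[/eqP ur /eqP us].
  have Es : E s = u |: E s.+1.
    apply/setP=> x; rewrite !inE (leq_eqVlt s) (eq_sym s) -us.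
    have [->|xu] := eqVneq x u; first by rewrite ur !eqxx.
    have [xr|] //= := eqVneq (row x) r;
      have [xs|] //= := eqVneq (col x) (col u).
    by rewrite (cell_inj (x := x) (y := u)) ?eqxx ?xr in xu.
  have uE : u \notin E s.+1 by rewrite inE us ltnn andbF.
  have cE : #|E s.+1| = arm u.
    by apply: eq_card => x; rewrite !inE ur us.
  apply: (@mulrn_inj_tf _ _ (arm u).+1) => //.
  rewrite -mulrnA mulnC mulrnA -us hook_step // -mulrnA mulnC mulrnA us IHs.
  rewrite -!mulrnA; congr (_ *+ _); rewrite Es cardsU1 uE cE add1n factS.
  rewrite [in RHS](bigD1 u) /=; last by rewrite inE ur us eqxx /=.
  rewrite -[in RHS](mulnA (cell_hook u)) mulnC -[in RHS]mulnA; congr (_ * _)%N.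
  rewrite mulnAC -mulnA; congr (_ * _)%N; apply: eq_bigl => x;
    rewrite !inE ltnS.
  have [->|xu] := eqVneq x u; first by rewrite us ltnn !andbF.
  rewrite andbT (leq_eqVlt (col x)); have [xr|] //= := eqVneq (row x) r.
  have [xs|] //= := eqVneq (col x) s.
  by rewrite (cell_inj (x := x) (y := u)) ?eqxx ?xr ?us in xu.
pose M := (\max_(x : T) col x).+1.
have colM x : (col x < M)%N by rewrite ltnS leq_bigmax.
have := main M; rewrite {main} /y y0.
have -> : rows_upto M = D.
  by apply/setP=> x; rewrite !inE colM andbT [RHS]leq_eqVlt orbC eq_sym.
have -> : #|E M| = 0%N.
  by apply: eq_card0 => x; rewrite !inE leqNgt colM andbF.
rewrite muln1 -mulrA -/b -/a !mulrA => ->; congr (_ *+ _).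
by apply: eq_bigl => x; rewrite colM andbT.
Qed.

End FirstRow.

(** Induction from the bottom row upwards. [first_row_square] leaves the column sum [b'] of the rows
    below between two row sums; the part [a1] of [a] belonging to row [r] commutes with [b'], and
    the induction hypothesis handles the rest. *)
Theorem young_elt_square r :
  young_elt r * young_elt r =
  young_elt r *+ \prod_(x in rows_from r) cell_hook x.
Proof.
pose M := \max_(x : T) row x.
have rowM x : (row x <= M)%N by rewrite /M leq_bigmax.
have [m] := ubnP (M.+1 - r); elim: m r => // m IHm r ltm.
have [rM|Mr] := ltnP M r.
  have D0 : rows_from r = set0.
    by apply/setP=> x; rewrite !inE leqNgt (leq_ltn_trans (rowM x) rM).
  by rewrite /young_elt D0 !stab_sum0 // !mulr1 big_set0.
have := IHm r.+1; rewrite subSS -ltnS -subSn // => /(_ ltm).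
set D := rows_from r; set D' := rows_from r.+1;
  pose D1 : {set T} := [set x | row x == r].
have DE : D = D1 :|: D'.
  by apply/setP=> x; rewrite !inE leq_eqVlt eq_sym.
have dD : [disjoint D1 & D'].
  by rewrite disjoints_subset; apply/subsetP=> x; rewrite !inE => /eqP->;
    rewrite ltnn.
have sD : D' \subset D by rewrite DE subsetUr.
rewrite /young_elt -/D -/D'.
set a := stab_sum rho false row D; set b := stab_sum rho true col D.
set a' := stab_sum rho false row D'; set b' := stab_sum rho true col D'.
pose a1 := stab_sum rho false row D1 => IH.
have aE : a = a1 * a'.
  rewrite /a DE (stab_sumU rho1 rhoM) // => x y; rewrite !inE => /eqP-> ry.
  by rewrite neq_ltn ry.
have a1a' : a1 * a' = a' * a1 by apply: stab_sum_comm.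
have a1b' : a1 * b' = b' * a1 by apply: stab_sum_comm.
have a1a1 : a1 * a1 = a1 *+ #|D1|`!.
  rewrite /a1 (stab_sum_sub_mull rhoM) //; congr (_ *+ _).
  rewrite -perm.card_Sym; apply: eq_card => p; rewrite [RHS]inE.
  apply/fiber_stabP/idP => [[]//|D1p]; split=> // x.
  have := perm_closed x D1p; rewrite !inE; have [->|xr] := eqVneq (row x) r.
    by move/eqP.
  by move=> _; rewrite (out_perm D1p) // inE.
pose k := \prod_(x in D') cell_hook x.
(* As [b] absorbs [b'] up to an integer, the last factor [b'] of the induction hypothesis can be
   replaced by [b]. *)
have IHb : a' * b' * (a' * b) = a' * b *+ k.
  have n0 : (0 < #|fiber_stab col D'|)%N.
    by apply/card_gt0P; exists 1%g; apply/fiber_stabP; split=> [|x];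
      rewrite ?perm_on1 ?perm1.
  have bE : b' * b = b *+ #|fiber_stab col D'| by rewrite stab_sum_sub_mull.
  apply: (mulrn_inj_tf n0); rewrite -[LHS]mulrnAr -mulrnAr -bE.
  rewrite [a' * (b' * b)]mulrA [LHS]mulrA IH mulrnAl -mulrA bE mulrnAr.
  by rewrite -!mulrnA mulnC.
apply: (@mulrn_inj_tf _ _ #|D1|`!) => //; first exact: fact_gt0.
rewrite (first_row_square r) -/D -/D1 -/a -/b -/D' -/b'.
have -> : a * (b' * a * b) = a * b *+ (k * #|D1|`!).
  rewrite {2}aE [b' * _]mulrA -a1b' -!mulrA [a * (a1 * _)]mulrA.
  rewrite {1}aE a1a' -[a' * a1 * a1]mulrA a1a1 mulrnAr -a1a' -aE mulrnAl.
  rewrite mulrnA; congr (_ *+ _).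
  by rewrite aE -!mulrA [a' * (b' * _)]mulrA IHb mulrnAr.
rewrite -!mulrnA; congr (_ *+ _); rewrite mulnAC; congr (_ * _)%N.
rewrite [RHS](eq_bigl [predU D1 & D']) => [|x]; last by rewrite DE !inE.
by rewrite bigU //= mulnC.
Qed.

End YoungSquare.

(** * Vanishing on elements of order divisible by l *)

Lemma card_porbit_dvd (T : finType) (s : {perm T}) (x : T) :
  (#|porbit s x| %| #[s]%g)%N.
Proof. by rewrite porbitE; apply: dvdn_orbit. Qed.

Lemma rot_fixed_flatten (T : Type) (d q : nat) (s : seq T) :
  size s = (q * d)%N -> seq.rot d s = s -> s = flatten (nseq q (take d s)).
Proof.
elim: q s => [|q IHq] s; first by move=> /size0nil->.
rewrite mulSn => szs; rewrite /seq.rot => srot.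
have sE : s = take d s ++ drop d s by rewrite cat_take_drop.
have sztd : size (take d s) = d by rewrite size_takel // szs leq_addr.
case: q IHq szs => [_|q IHq] szs.
  by rewrite mul0n addn0 in szs; rewrite /= cats0 take_oversize // szs.
pose v := drop d s;
  have szv : size v = (q.+1 * d)%N by rewrite size_drop szs addKn.
have tv : take d v = take d s.
  by rewrite -[in RHS]srot takel_cat // szv mulSn leq_addr.
rewrite -[flatten _]/(take d s ++ flatten (nseq q.+1 (take d s))).
have := IHq v szv; rewrite tv => <-; first exact: sE.
rewrite /seq.rot tv.
have : drop d (v ++ take d s) = drop d s by rewrite /v srot.
rewrite drop_cat; case: ltnP => // vd; rewrite (drop_oversize vd).
have -> : (d - size v = 0)%N by apply/eqP; rewrite subn_eq0 szv mulSn leq_addr.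
by rewrite drop0.
Qed.

(** * Words up to cyclic rotation *)

Section WordSums.

Variables (gT : finGroupType) (c theta : gT -> int) (l : nat).
Hypothesis l_prime : prime l.
Hypothesis thetaC : forall x y, theta (x * y)%g = theta (y * x)%g.

(** The linear extension of [theta], evaluated at the [N]-th power of the group algebra element with
    coefficients [c]. *)
Definition word_sum (N : nat) : int :=
  \sum_(t : N.-tuple gT) (\prod_(x <- t) c x) * theta (\prod_(x <- t) x)%g.

(* Words are grouped by cyclic rotation: a word with a small rotation orbit is
   periodic, so that its product is a high power. *)
Lemma dvdz_word_sum (m k : nat) :
  (forall x, theta (x ^+ (l ^ m)%N)%g = 0) ->
  ((l ^ k)%N%:Z %| word_sum (l ^ (m + k))%N)%Z.
Proof.
move NE: (l ^ (m + k))%N => N theta0.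
pose F (t : N.-tuple gT) := (\prod_(x <- t) c x) * theta (\prod_(x <- t) x)%g.
pose rot1 (t : N.-tuple gT) := [tuple of seq.rot 1 t].
have rot1_inj : injective rot1.
  by move=> t1 t2 /(congr1 val) /rot_inj eq_t; apply: val_inj.
pose s := perm rot1_inj.
have sX i t : (i <= N)%N -> val (iter i s t) = seq.rot i t.
  elim: i => [|i IHi] iN; first by rewrite rot0.
  by rewrite iterS permE /= IHi ?(ltnW iN) // -rotD ?size_tuple.
have Frot i t : (i <= N)%N -> F (iter i s t) = F t.
  move=> iN; rewrite /F sX // /seq.rot -[in RHS](cat_take_drop i t) !big_cat /=.
  by rewrite thetaC [X in X * _]mulrC.
have sN : (s ^+ N = 1)%g.
  apply/permP=> t; rewrite permX perm1; apply/val_inj.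
  by rewrite sX // rot_oversize ?size_tuple.
have cardP t : (#|porbit s t| %| N)%N.
  by apply: dvdn_trans (card_porbit_dvd s t) _; rewrite order_dvdn sN.
have Fporbit t t' : t' \in porbit s t -> F t' = F t.
  case/porbitP=> i ->; elim: i => [|i IHi]; first by rewrite perm1.
  rewrite expgSr permM -{}IHi -(Frot 1%N ((s ^+ i)%g t)) //.
  by rewrite -NE expn_gt0 prime_gt0.
rewrite -[word_sum N]/(\sum_t F t) (partition_big (porbit s) predT) //=.
apply: rpred_sum => O _.
have [t0 /eqP <-|noO] := pickP (fun t => porbit s t == O);
  last by rewrite big_pred0 ?rpred0.
rewrite (eq_bigl (mem (porbit s t0))) => [|t]; last by rewrite eq_porbit_mem.
rewrite (eq_bigr (fun=> F t0)) => [|t]; last exact: Fporbit.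
rewrite sumr_const -mulr_natr.
have [j jle cO] : exists2 j, (j <= m + k)%N & #|porbit s t0| = (l ^ j)%N.
  by apply/(dvdn_pfactor _ _ l_prime); rewrite NE.
(* An orbit of size [l ^ j] with [k <= j] contributes a multiple of [l ^ k]. If [j < k], the product
   of the word is a power with exponent [l ^ (m + k - j)], a multiple of [l ^ m], and [theta]
   vanishes there. *)
have [kj|jk] := leqP k j.
  apply: dvdz_mull; rewrite cO natz dvdzE /=; exact: dvdn_exp2l.
have -> : F t0 = 0; last by rewrite mul0r rpred0.
have rot_t0 : seq.rot (l ^ j)%N t0 = t0.
  have := iter_porbit s t0; rewrite cO => /(congr1 val); rewrite sX //.
  by rewrite -NE leq_exp2l ?prime_gt1.
have sz0 : size t0 = (l ^ (m + k - j) * l ^ j)%N.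
  by rewrite -expnD subnK // size_tuple NE.
rewrite /F {2}(rot_fixed_flatten sz0 rot_t0).
have -> : (\prod_(x <- flatten (nseq (l ^ (m + k - j))%N (take (l ^ j)%N t0)))
  x =
   (\prod_(x <- take (l ^ j)%N t0) x) ^+ (l ^ (m + k - j))%N)%g.
  elim: (l ^ (m + k - j))%N => [|i IHi]; first by rewrite big_nil.
  by rewrite /= big_cat /= IHi expgS.
by rewrite -addnBA 1?ltnW // expnD mulnC expgM theta0 mulr0.
Qed.

End WordSums.

(** * Characters of right ideals generated by a multiple of an idempotent *)

Section RegularIdempotent.

Variables (gT : finGroupType) (c : gT -> int) (k : nat).

Let G := [set: gT]%G.
Let aG := regular_repr algC G.
Let C : 'M[algC]_#|G| := \sum_(s : gT) (c s)%:~R *: aG s.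
Let u := gring_row C.

Hypothesis k_gt0 : (0 < k)%N.
Hypothesis C_sqr : C *m C = k%:R *: C.

(** The trace of [h |-> s * h * g] on the group algebra. *)
Definition fix_count (g s : gT) : int :=
  #|[set h : gT | (s * h * g == h)%g]|%:Z.

Definition class_weight (g : gT) : int := \sum_(s : gT) c s * fix_count g s.

Lemma gring_row_elt (s : gT) : gring_row (aG s) = delta_mx 0 (gring_index G s).
Proof. by rewrite /gring_row rowK gring_indexK ?group1 // mul1g. Qed.

Lemma gring_row_sum : u = \sum_(s : gT) (c s)%:~R *: delta_mx 0 (gring_index G
  s).
Proof.
rewrite /u /C linear_sum /=; apply: eq_bigr => s _.
by rewrite linearZ /= gring_row_elt.
Qed.

(* Left multiplication by the element u of the group algebra. *)
Let E : 'M[algC]_#|G| := \matrix_i (u *m aG (enum_val i)).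

Lemma delta_left_mul (s : gT) : delta_mx 0 (gring_index G s) *m E = u *m aG s.
Proof. by rewrite -rowE rowK gring_indexK ?inE. Qed.

Lemma gring_row_mulE (h : gT) :
  u *m aG h = \sum_(s : gT) (c s)%:~R *: delta_mx 0 (gring_index G (s * h)%g).
Proof.
rewrite gring_row_sum mulmx_suml; apply: eq_bigr => s _.
by rewrite -scalemxAl -rowE rowK gring_indexK ?inE.
Qed.

Lemma left_mul_sqr : E *m E = k%:R *: E.
Proof.
apply/row_matrixP=> i;
  rewrite row_mul linearZ /= rowK gring_row_mulE mulmx_suml.
set h := enum_val i.
transitivity (gring_row (C *m C) *m aG h); last first.
  by rewrite C_sqr linearZ /= -scalemxAl gring_row_mulE.
rewrite gring_row_mul -mulmxA mulmx_suml mulmx_sumr; apply: eq_bigr => s _.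
by rewrite -!scalemxAl delta_left_mul repr_mxM ?inE // scalemxAr.
Qed.

Lemma left_mul_cyclic : (E :=: cyclic_mx aG u)%MS.
Proof.
apply/eqmxP/andP; split.
  apply/row_subP=> i; rewrite rowK mxmodule_trans ?cyclic_mx_module ?inE //.
  exact: cyclic_mx_id.
apply: cyclic_mx_sub.
  apply/mxmoduleP=> x _; apply/row_subP=> i; rewrite row_mul rowK -mulmxA.
  by rewrite -repr_mxM ?inE // -delta_left_mul submxMl.
by rewrite -[u]mulmx1 -(repr_mx1 aG) -delta_left_mul submxMl.
Qed.

Lemma trace_left_mul (g : gT) : \tr (E *m aG g) = (class_weight g)%:~R.
Proof.
rewrite /mxtrace (reindex_onto (gring_index G) enum_val) /=; last first.
  by move=> i _; apply: gring_valK.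
have -> : (class_weight g)%:~R =
    \sum_(h : gT) \sum_(s : gT) (c s)%:~R * (s * h * g == h)%g%:R :> algC.
  rewrite exchange_big /class_weight rmorph_sum /=; apply: eq_bigr => s _.
  rewrite rmorphM /= -mulr_sumr; congr (_ * _).
  rewrite /fix_count -pmulrn -sum1dep_card natr_sum big_mkcond /=.
  by apply: eq_bigr => h _; case: eqP.
apply: eq_big => [h|h _]; first by rewrite gring_indexK ?inE ?eqxx.
set i := gring_index G h.
transitivity (row i (E *m aG g) 0 i); first by rewrite [RHS]mxE.
rewrite row_mul rowK gring_indexK ?inE // -mulmxA -repr_mxM ?inE //.
rewrite gring_row_mulE summxE; apply: eq_bigr => s _; rewrite !mxE eqxx /=.
by rewrite mulgA eq_sym (inj_in_eq (can_in_inj (@gring_indexK _ G))) ?inE.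
Qed.

(** [E / k] projects onto the right ideal and commutes with right multiplication, so the trace of
    [E *m aG g] is [k] times the character value. Keeping [k] on the left makes the right side an
    integer. *)
Lemma cfRepr_cyclic (g : gT) :
  cfRepr (submod_repr (cyclic_mx_module aG u)) g *+ k = (class_weight g)%:~R.
Proof.
rewrite cfunE inE mulr1n.
set W := cyclic_mx aG u; set modW := cyclic_mx_module aG u.
(* With [B] a basis of the ideal, [E = X *m B] and [B *m X] is the scalar [k]; cyclicity of the
   trace then gives [k] times the trace of [S]. *)
pose B := val_submod (U := W) 1%:M; pose S := submod_mx modW g.
have sEB : (E <= B)%MS by rewrite val_submod1 left_mul_cyclic.
have sBE : (B <= E)%MS by rewrite val_submod1 left_mul_cyclic.
have [X EX] := submxP sEB; have [Y BY] := submxP sBE.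
have BE : B *m E = k%:R *: B
  by rewrite {1}BY -mulmxA left_mul_sqr -scalemxAr -BY.
have BX : B *m X = k%:R *: 1%:M.
  apply: (@val_submod_inj _ _ W); rewrite val_submodE -/B -mulmxA -EX BE.
  by rewrite linearZ.
have SB : S *m B = B *m aG g.
  by rewrite -val_submodE -[S]mul1mx val_submodJ ?inE.
rewrite -[X in X *+ k]/(\tr S) -trace_left_mul; move: S SB => S SB.
rewrite EX -mulmxA -SB mulmxA.
by rewrite mxtrace_mulC mulmxA BX -scalemxAl mul1mx mxtraceZ mulr_natl.
Qed.

Lemma big_tuple_cons (R : nmodType) (N : nat) (F : N.+1.-tuple gT -> R) :
  \sum_(t : N.+1.-tuple gT) F t =
  \sum_(s : gT) \sum_(t : N.-tuple gT) F [tuple of s :: t].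
Proof.
rewrite pair_big /= (reindex (fun p : gT * N.-tuple gT =>
  [tuple of p.1 :: p.2])) //.
exists (fun t : N.+1.-tuple gT => (thead t, [tuple of behead t])) =>
  [[s t]|t] _.
  by congr pair; apply: val_inj.
by rewrite [RHS]tuple_eta; apply: val_inj.
Qed.

Lemma iter_gring_sum (N : nat) :
  iter N (mulmx C) 1%:M =
  \sum_(t : N.-tuple gT) (\prod_(x <- t) c x)%:~R *: aG (\prod_(x <- t) x)%g.
Proof.
elim: N => [|N IHN].
  rewrite (eq_bigl (pred1 [tuple])) => [|t]; last first.
    by apply/esym/eqP/val_inj/size0nil/size_tuple.
  by rewrite big_pred1_eq !big_nil scale1r repr_mx1.
rewrite iterS IHN big_tuple_cons mulmx_suml; apply: eq_bigr => s _.
rewrite mulmx_sumr; apply: eq_bigr => t _.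
by rewrite !big_cons repr_mxM ?inE // rmorphM -scalemxAr -scalemxAl scalerA
  mulrC.
Qed.

Lemma iter_gring_sqr (N : nat) : iter N.+1 (mulmx C) 1%:M = (k ^ N)%:R *: C.
Proof.
elim: N => [|N IHN]; first by rewrite /= mulmx1 scale1r.
by rewrite iterS IHN -scalemxAr C_sqr scalerA -natrM -expnSr.
Qed.

Lemma word_coef (N : nat) (s : gT) :
  \sum_(t : N.+1.-tuple gT | (\prod_(x <- t) x)%g == s) \prod_(x <- t) c x
    = (k ^ N)%:Z * c s.
Proof.
apply: (@intr_inj algC); rewrite rmorph_sum rmorphM /= -pmulrn.
have coefE (I : finType) (d : I -> algC) (f : I -> gT) :
    gring_row (\sum_i d i *: aG (f i)) 0 (gring_index G s) = \sum_(i | f i ==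
      s) d i.
  rewrite linear_sum summxE [RHS]big_mkcond; apply: eq_bigr => i _ /=.
  rewrite linearZ /= gring_row_elt !mxE eqxx eq_sym /=.
  rewrite (inj_in_eq (can_in_inj (@gring_indexK _ G))) ?inE //.
  by case: eqP; rewrite ?mulr1 ?mulr0.
rewrite -(coefE _ (fun t : N.+1.-tuple gT => (\prod_(x <- t) c x)%:~R)).
rewrite -iter_gring_sum iter_gring_sqr linearZ /= mxE; congr (_ * _).
by rewrite /C (coefE _ (fun s => (c s)%:~R) id) big_pred1_eq.
Qed.

Lemma word_sum_class_weight (g : gT) (N : nat) :
  word_sum c (fix_count g) N.+1 = (k ^ N)%:Z * class_weight g.
Proof.
rewrite /word_sum (partition_big (fun t : N.+1.-tuple gT =>
  (\prod_(x <- t) x)%g) predT) //=.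
rewrite mulr_sumr; apply: eq_bigr => s _; rewrite mulrA -word_coef mulr_suml.
by apply: eq_bigr => t /eqP->.
Qed.

(** Left multiplication by [y] is a bijection between the two sets counted. *)
Lemma fix_countC (g x y : gT) : fix_count g (x * y)%g = fix_count g (y * x)%g.
Proof.
congr Posz; rewrite -(card_imset _ (mulgI y)); apply: eq_card => h; rewrite inE.
apply/imsetP/eqP => [[h']|hE].
  by rewrite inE => /eqP hE ->; rewrite -{2}hE !mulgA.
exists (y^-1 * h)%g; last by rewrite mulKVg.
rewrite inE -[(x * y * _)%g]mulgA mulKVg; apply/eqP.
by rewrite -{2}hE !mulgA mulVg mul1g.
Qed.

Variable l : nat.
Hypothesis l_prime : prime l.
Hypothesis l_k : ~~ (l %| k)%N.

Lemma class_weight_singular (g : gT) : (l %| #[g]%g)%N -> class_weight g = 0.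
Proof.
(* With [m = #|G|], raising to the power [l ^ m] removes the [l]-part of every order, so
   [x ^+ (l ^ m)] has order prime to [l] and is not conjugate to the inverse of [g]. *)
move=> lg; pose m := #|G|.
have lm : (m < l ^ m)%N by apply: ltn_expl; exact: prime_gt1.
have fix0 x : fix_count g (x ^+ (l ^ m)%N)%g = 0.
  rewrite /fix_count;
    case: (pickP [pred h | (x ^+ (l ^ m)%N * h * g == h)%g]) => [h|].
    move=> /= /eqP hE.
    have gE : g = ((x^-1 ^ h) ^+ (l ^ m)%N)%g.
      apply: (mulgI (x ^+ (l ^ m)%N * h)%g).
      by rewrite hE -conjXg expgVn /conjg mulgA mulgK mulKVg.
    move: lg; rewrite gE; set z := (_ ^ h)%g; rewrite orderXgcd => lz.
    have z_gt0 := order_gt0 z; pose e := logn l #[z]%g.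
    have le_z : (l ^ e %| #[z]%g)%N by rewrite pfactor_dvdnn.
    have e_m : (e <= m)%N.
      apply: (leq_trans (ltnW (ltn_expl e (prime_gt1 l_prime)))).
      apply: (leq_trans (dvdn_leq z_gt0 le_z)); apply: subset_leq_card.
      exact: subsetT.
    have : (l ^ e.+1 %| #[z]%g)%N.
      rewrite expnS -(divnK (dvdn_gcdl #[z]%g (l ^ m))) dvdn_mul //.
      by rewrite dvdn_gcd le_z dvdn_exp2l.
    by rewrite pfactor_dvdn // ltnn.
  move=> noh; congr Posz; apply: eq_card0 => h; rewrite inE; exact: noh.
have dvd i : ((l ^ i)%N%:Z %| class_weight g)%Z.
  have := dvdz_word_sum c l_prime (fix_countC g) i fix0.
  have -> : (l ^ (m + i) = (l ^ (m + i)).-1.+1)%N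
    by rewrite prednK ?expn_gt0 ?prime_gt0.
  rewrite word_sum_class_weight !dvdzE abszM /= Gauss_dvdr //.
  by rewrite coprimeXl // coprimeXr // prime_coprime.
(* Every power of [l] divides the weight; the exponent equal to its absolute value already gives a
   power that is too large unless the weight is 0. *)
apply/eqP; rewrite -absz_eq0; apply/eqP.
have := dvd `|class_weight g|%N; rewrite dvdzE /= => /dvdn_leq.
by case: `|_|%N => // n /(_ isT); rewrite leqNgt ltn_expl ?prime_gt1.
Qed.

Lemma cfRepr_cyclic_singular (g : gT) : (l %| #[g]%g)%N ->
  cfRepr (submod_repr (cyclic_mx_module aG u)) g = 0.
Proof.
move=> /class_weight_singular w0; have := cfRepr_cyclic g; rewrite w0 => /eqP.
by rewrite mulrn_eq0 -leqn0 leqNgt k_gt0 => /eqP.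
Qed.

End RegularIdempotent.

(** * Specht characters of cores *)

Lemma leq_nth_sorted_geq (la : seq nat) (i j : nat) :
  sorted geq la -> (i <= j)%N -> (nth 0 la j <= nth 0 la i)%N.
Proof.
move=> sla ij; have [jsz|] := ltnP j (size la);
  last by move=> /(nth_default 0)->.
apply: (sorted_leq_nth _ _ 0%N sla) => //; rewrite ?inE //.
- by move=> x y z /= xy /leq_trans->.
- exact: leqnn.
- exact: leq_ltn_trans ij jsz.
Qed.

Lemma ltn_column_length (la : seq nat) (r j : nat) :
  sorted geq la -> (r < column_length la j)%N = (j < nth 0 la r)%N.
Proof.
move=> sla; rewrite /column_length; elim: la r sla => [|x la IHla] r sla.
  by rewrite nth_nil !ltn0.
have sla' : sorted geq la by apply: path_sorted sla.
have le_x i : (nth 0 la i <= x)%N by have :=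
  @leq_nth_sorted_geq (x :: la) 0 i.+1 sla isT.
case: r => [|r] /=; have [jx|xj] := ltnP j x;
  rewrite ?add1n ?ltnS ?add0n ?IHla //.
  by rewrite ltnNge (leq_trans (le_x 0%N) xj).
by rewrite !ltnNge (leq_trans (le_x r.+1) xj) (leq_trans (le_x r) xj).
Qed.

(** * Diagrams of partitions and their Specht modules *)

Section PartitionDiagram.

Variables (n : nat) (la : seq nat).
Hypothesis la_part : is_partition n la.

Let row (x : 'I_n) := reshape_index la x.
Let col (x : 'I_n) := reshape_offset la x.

Let sla : sorted geq la. Proof. by case/and3P: la_part. Qed.
Let sumla : sumn la = n. Proof. by case/and3P: la_part => _ _ /eqP. Qed.

Lemma diagram_cell_inj (x y : 'I_n) : row x = row y -> col x = col y -> x = y.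
Proof.
move=> rxy cxy; apply: val_inj; rewrite /= -(reshape_indexK la x).
by rewrite -[reshape_index la x]/(row x) -[reshape_offset la x]/(col x) rxy cxy
  reshape_indexK.
Qed.

Lemma diagram_col_lt (x : 'I_n) : (col x < nth 0 la (row x))%N.
Proof. by apply: reshape_offsetP; rewrite sumla. Qed.

Lemma diagram_row_lt (x : 'I_n) : (row x < size la)%N.
Proof. by apply: reshape_indexP; rewrite sumla. Qed.

Lemma diagram_cell (r c : nat) :
  (c < nth 0 la r)%N -> exists2 y : 'I_n, row y = r & col y = c.
Proof.
move=> cr;
  have lt_n : (flatten_index la r c < n)%N by rewrite -sumla flatten_indexP.
by exists (Ordinal lt_n);
  rewrite ?[row _]flatten_indexKl ?[col _]flatten_indexKr.
Qed.

Lemma diagram_cell_down (x : 'I_n) (r c : nat) :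
  (r <= row x)%N -> (c <= col x)%N -> exists2 y : 'I_n, row y = r & col y = c.
Proof.
move=> rx cx; apply: diagram_cell; apply: leq_ltn_trans cx _.
exact: leq_trans (diagram_col_lt x) (leq_nth_sorted_geq _ _).
Qed.

Lemma card_iota_imset (T : finType) (A : {set T}) (f : T -> nat) (i j : nat) :
  {in A &, injective f} ->
  (forall x, x \in A -> (i <= f x < j)%N) ->
  (forall m, (i <= m < j)%N -> exists2 x, x \in A & f x = m) ->
  #|A| = (j - i)%N.
Proof.
move=> f_inj fA Af; rewrite cardE -(size_map f) -(size_iota i (j - i)).
apply/perm_size/uniq_perm; rewrite ?iota_uniq //.
  by rewrite map_inj_in_uniq ?enum_uniq // => x y; rewrite !mem_enum;
    apply: f_inj.
move=> m; rewrite mem_iota; apply/mapP/idP => [[x]|].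
  rewrite mem_enum => /fA/andP[ix xj] ->; rewrite ix subnKC //.
  exact: leq_trans (leq_trans ix (leqnSn _)) xj.
case/andP=> im mj; have [|x xA <-] := Af m; last by exists x; rewrite ?mem_enum.
rewrite im; have [ij|/ltnW/eqP ji] := leqP i j; first by rewrite subnKC in mj.
by rewrite ji addn0 ltnNge im in mj.
Qed.

Lemma cell_hook_length (x : 'I_n) :
  cell_hook row col x = hook_length la (row x) (col x).
Proof.
have cx := diagram_col_lt x; have rx : (row x < column_length la (col x))%N.
  by rewrite ltn_column_length.
have armE : arm row col x = (nth 0 la (row x) - (col x).+1)%N.
  apply: (@card_iota_imset _ _ col) => [y z|y|m /andP[xm mr]].
  - rewrite !inE => /andP[/eqP ry _] /andP[/eqP rz _].
    by apply: diagram_cell_inj; rewrite ry rz.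
  - by rewrite inE => /andP[/eqP <- ->]; apply: diagram_col_lt.
  - by have [y ry cy] := diagram_cell mr; exists y;
    rewrite // inE ry cy xm eqxx.
have legE : leg row col x = (column_length la (col x) - (row x).+1)%N.
  apply: (@card_iota_imset _ _ row) => [y z|y|m /andP[xm mc]].
  - rewrite !inE => /andP[/eqP cy _] /andP[/eqP cz _] ryz.
    by apply: diagram_cell_inj; rewrite // cy cz.
  - by rewrite inE => /andP[/eqP <- ->];
    rewrite ltn_column_length ?diagram_col_lt.
  - have [y ry cy] : exists2 y : 'I_n, row y = m & col y = col x.
      by apply: diagram_cell; rewrite -ltn_column_length.
    by exists y; rewrite // inE ry cy xm eqxx.
rewrite /cell_hook armE legE /hook_length.
move: (nth 0 la (row x)) (column_length la (col x)) (row x) (col x) cx rx.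
by move=> a b r c ca rb; lia.
Qed.

Let rho := regular_repr algC [set: 'S_n]%G.

(** The coordinates of the Young symmetrizer taken in [int], where divisibility by powers of [l]
    makes sense. *)
Let coef (s : 'S_n) : int :=
  \sum_(p in row_stabilizer n la) \sum_(q in column_stabilizer n la | (p * q)%g
    == s)
    (-1) ^+ q.

Lemma sum_coef (V : lmodType algC) (F : 'S_n -> V) :
  \sum_(s : 'S_n) (coef s)%:~R *: F s =
  \sum_(p in row_stabilizer n la) \sum_(q in column_stabilizer n la)
    (-1) ^+ q *: F (p * q)%g.
Proof.
under eq_bigr => s _ do rewrite /coef rmorph_sum scaler_suml.
rewrite exchange_big; apply: eq_bigr => p _ /=.
rewrite [RHS](partition_big (fun q => (p * q)%g) predT) //=;
  apply: eq_bigr => s _.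
rewrite rmorph_sum scaler_suml; apply: eq_bigr => q /andP[_ /eqP->].
by rewrite rmorph_sign.
Qed.

Lemma fiber_stab_rows_from0 (f : 'I_n -> nat) :
  fiber_stab f (rows_from row 0) = [set p : 'S_n | [forall i, f (p i) == f i]].
Proof.
apply/setP=> p; rewrite !inE; suff -> : perm_on (rows_from row 0) p by [].
by apply/subsetP=> x _; rewrite inE.
Qed.

Lemma coef_square :
  let C := \sum_(s : 'S_n) (coef s)%:~R *: rho s in
  C *m C = (\prod_x cell_hook row col x)%:R *: C.
Proof.
move=> C.
have CE : C = young_elt row col (rho : _ -> 'M[algC]_#|[set: 'S_n]|) 0.
  rewrite /C sum_coef /young_elt /stab_sum !fiber_stab_rows_from0 mulr_suml.
  apply: eq_bigr => p _; rewrite mulr_sumr; apply: eq_bigr => q _.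
  rewrite /= expr0 mul1r repr_mxM ?inE //.
  rewrite -[RHS]/(rho p *m ((-1) ^+ q *m rho q)).
  by case: (odd_perm q);
    rewrite ?expr0 ?expr1 ?scale1r ?mul1mx // scaleN1r mulNmx mul1mx mulmxN.
have rho1 : rho 1%g = 1 :> 'M[algC]_#|[set: 'S_n]| by rewrite repr_mx1.
have rhoM (s t : 'S_n) : rho (s * t)%g = rho s * rho t :> 'M[algC]_#|[set:
  'S_n]|.
  by rewrite repr_mxM ?inE.
have tf (X : 'M[algC]_#|[set: 'S_n]|) (m : nat) : X *+ m.+1 = 0 -> X = 0.
  by move/eqP; rewrite -scaler_nat scaler_eq0 pnatr_eq0 => /eqP.
have sqr := young_elt_square diagram_cell_inj diagram_cell_down rho1 rhoM tf 0.
rewrite -[C *m C]/(C * C) CE {}sqr -scaler_nat; congr (_%:R *: _).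
by apply: eq_bigl => x; rewrite inE.
Qed.

Lemma specht_charE :
  specht_char n la = cfRepr (submod_repr (cyclic_mx_module rho
    (gring_row (\sum_(s : 'S_n) (coef s)%:~R *: rho s)))).
Proof.
rewrite /specht_char.
have -> // : young_symmetrizer n la = gring_row (\sum_(s : 'S_n) (coef s)%:~R
  *: rho s).
by rewrite gring_row_sum sum_coef.
Qed.

Lemma specht_char_core_singular (l : nat) (g : 'S_n) :
  prime l -> is_core l la -> (l %| #[g]%g)%N -> specht_char n la g = 0.
Proof.
move=> l_prime la_core lg; rewrite specht_charE.
apply: (cfRepr_cyclic_singular _ coef_square l_prime) lg.
  by rewrite prodn_gt0.
apply: (big_ind (fun m => ~~ (l %| m)%N)).
- by rewrite dvdn1 neq_ltn prime_gt1 ?orbT.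
- by move=> x y lx ly; rewrite Euclid_dvdM // negb_or lx.
move=> x _; rewrite cell_hook_length.
exact: la_core (diagram_row_lt x) (diagram_col_lt x).
Qed.

End PartitionDiagram.

(** * Parts of large cores *)

(** This is [2 * l ^ 2] times the variance, written over pairs so that most of it can be bounded
    pair by pair. *)
Definition pair_spread (l : nat) (q : nat -> rat) : rat :=
  \sum_(0 <= i < l) \sum_(0 <= i' < l) (q i - q i') ^+ 2.

Lemma pair_spreadE l q :
  pair_spread l q =
  2 * (l%:R * (\sum_(0 <= i < l) q i ^+ 2) - (\sum_(0 <= i < l) q i) ^+ 2).
Proof.
set S := \sum_(0 <= i < l) q i ^+ 2; set P := \sum_(0 <= i < l) q i.
have inner i : \sum_(0 <= i' < l) (q i - q i') ^+ 2
    = l%:R * q i ^+ 2 - 2 * P * q i + S.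
  rewrite (eq_bigr (fun i' => q i ^+ 2 + (- (2 * q i) * q i' + q i' ^+ 2))) =>
    [|i' _].
    rewrite !big_split /= sumr_const_nat subn0 -mulr_sumr -/P -/S; ring.
  ring.
rewrite /pair_spread (eq_bigr _ (fun i _ => inner i)).
rewrite !big_split /= sumr_const_nat subn0 -mulr_sumr -/S sumrN -mulr_sumr -/P;
  ring.
Qed.

Lemma sum_id_rat l : \sum_(0 <= i < l) i%:R = l%:R * (l%:R - 1) / 2 :> rat.
Proof.
elim: l => [|l IHl]; first by rewrite big_nil mul0r.
by rewrite big_nat_recr //= IHl -natr1; field.
Qed.

Lemma sum_sqr_rat l :
  \sum_(0 <= i < l) i%:R ^+ 2 = l%:R * (l%:R - 1) * (2 * l%:R - 1) / 6 :> rat.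
Proof.
elim: l => [|l IHl]; first by rewrite big_nil !mul0r.
by rewrite big_nat_recr //= IHl -natr1; field.
Qed.

Lemma pair_spread_scale l (a : rat) :
  pair_spread l (fun i =>
    i%:R * a) = a ^+ 2 * (l%:R ^+ 2 * (l%:R ^+ 2 - 1) / 6).
Proof.
rewrite pair_spreadE (eq_bigr (fun i => a ^+ 2 * i%:R ^+ 2)) => [|i _];
  last by ring.
by rewrite -mulr_sumr -mulr_suml sum_id_rat sum_sqr_rat; field.
Qed.

(** Equality holds at [j = 2], and each later term adds enough on the right. At [j = 1] the
    inequality fails. *)
Lemma sum_shift_sqr_ge (x : rat) (j : nat) : 0 <= x -> (1 < j)%N ->
  j%:R * (2 * x ^+ 2 + 2 * x + 1) <= 2 * \sum_(0 <= r < j) (x + r%:R) ^+ 2.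
Proof.
move=> x0; elim: j => // -[//|[|j]] IHj _.
  rewrite !big_nat_recr // big_nil /=; lra.
rewrite big_nat_recr //= -natr1; have {IHj} := IHj isT.
have j0 : 0 <= j%:R :> rat by rewrite ler0n.
have -> : j.+2%:R = j%:R + 2 :> rat by rewrite -[j.+2]addn2 natrD.
set S := \sum_(0 <= r < _) _; nra.
Qed.

(** * Comparison with an arithmetic progression *)

Section SpreadBound.

Variables (l j : nat) (q : nat -> rat).
Hypothesis l_gt1 : (1 < l)%N.
Hypothesis j_gt0 : (0 < j)%N.
Hypothesis j_le : (j <= l)%N.

Let L : rat := l%:R.
Let d := L ^+ 2 - L - 1.
(** The progression of this difference has the spread that corresponds to [core_bound]. It exceeds
    the step bound [d] by 2, which makes up for the larger jump at [j]. *)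
Let d' := L ^+ 2 - L + 1.

Hypothesis q_low : forall i, (i < j)%N -> 0 <= q i <= L - 1.
Hypothesis q_mono : forall i i', (i <= i' < l)%N -> q i <= q i'.
Hypothesis q_jump : (j < l)%N -> q j <= L ^+ 2 - 1.
Hypothesis q_step : forall i, (j <= i)%N -> (i.+1 < l)%N -> q i.+1 <= q i + d.

Let L_ge2 : 2 <= L. Proof. by rewrite /L ler_nat. Qed.

Lemma spread_high (i m : nat) :
  (j <= i)%N -> (i + m < l)%N -> q (i + m)%N <= q i + m%:R * d.
Proof.
move=> ji; elim: m => [|m IHm]; first by rewrite addn0 mul0r addr0.
rewrite addnS => im; have := IHm (ltnW im).
have := q_step (leq_trans ji (leq_addr m i)) im; rewrite -natr1; lra.
Qed.

Lemma ler_sqr_of_le (x y : rat) : 0 <= x -> x <= y -> x ^+ 2 <= y ^+ 2.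
Proof. move=> x0 xy; nra. Qed.

(** On one side of [j] the bound holds pair by pair: below [j] all differences are at most
    [L - 1 <= d'], and from [j] on each step is at most [d <= d']. *)
Lemma spread_term (i i' : nat) : (i <= i' < l)%N ->
  (i' < j)%N || (j <= i)%N ->
  (q i - q i') ^+ 2 <= (i%:R * d' - i'%:R * d') ^+ 2.
Proof.
move=> /andP[ii' i'l] side; have [<-|neq] := eqVneq i i'.
  by rewrite !subrr expr0n.
have lt_ii' : (i < i')%N by rewrite ltn_neqAle neq.
have qq : q i <= q i' by apply: q_mono; rewrite ii'.
have d1 : 1 <= (i' - i)%:R :> rat by rewrite ler1n subn_gt0.
suff le : q i' - q i <= (i' - i)%:R * d'.
  have := ler_sqr_of_le (_ : 0 <= q i' - q i) le; rewrite subr_ge0 => /(_ qq).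
  by rewrite natrB // -[(q i - q i') ^+ 2]sqrrN opprB -[(i%:R * _ - _) ^+
    2]sqrrN opprB mulrBl.
have L2 := L_ge2; case/orP: side => [i'j|ji].
  have /andP[_ h1] := q_low i'j;
    have /andP[h2 _] := q_low (leq_ltn_trans ii' i'j).
  have dL : L - 1 <= d' by rewrite /d'; nra.
  have : d' <= (i' - i)%:R * d' by apply: ler_peMl => //; lra.
  lra.
have := spread_high (m := i' - i) ji; rewrite subnKC // => /(_ i'l).
have -> : d' = d + 2 by rewrite /d /d'; ring.
lra.
Qed.

Lemma spread_cross (i m : nat) : (i < j)%N -> (j + m < l)%N ->
  (q i - q (j + m)%N) ^+ 2 <= (L + m.+1%:R * d) ^+ 2.
Proof.
move=> ij jm; have /andP[qi0 _] := q_low ij.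
have qj : q j <= L ^+ 2 - 1 by apply/q_jump/(leq_ltn_trans (leq_addr m j)).
have := spread_high (leqnn j) jm.
have : q i <= q (j + m)%N by apply: q_mono;
  rewrite jm andbT (leq_trans (ltnW ij)) ?leq_addr.
move=> h1 h2; rewrite -[(q i - _) ^+ 2]sqrrN opprB; apply: ler_sqr_of_le;
  first lra.
rewrite -natr1 mulrDl mul1r /d; move: h2; rewrite /d; lra.
Qed.

(** Across the jump the bound may fail for a single pair, since [q j - q i] can exceed [d'] for
    adjacent indices; it is recovered by summing over [i]. *)
Lemma spread_cross_sum :
  \sum_(0 <= i < j) \sum_(j <= i' < l) (q i - q i') ^+ 2 <=
  \sum_(0 <= i < j) \sum_(j <= i' < l) (i%:R * d' - i'%:R * d') ^+ 2.
Proof.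
have L2 := L_ge2.
apply: (@le_trans _ _ (\sum_(0 <= i < j) \sum_(0 <= m < l - j) (L + m.+1%:R *
  d) ^+ 2)).
  rewrite big_nat [leRHS]big_nat; apply: ler_sum => i /andP[_ ij].
  rewrite -{1}[j]add0n big_addn big_nat [leRHS]big_nat; apply: ler_sum => m.
  rewrite ltn_subRL => /andP[_ mj]; rewrite addnC; exact: spread_cross.
rewrite exchange_big_nat [leRHS]exchange_big_nat /=.
rewrite -[in leRHS](add0n j) big_addn.
(* For [j = 1] and [l > 2] the estimate fails at [m = 0], so the sum over [m] is evaluated in closed
   form. *)
have [j1|j_gt1] := leqP j 1.
  have -> : j = 1%N by apply/eqP; rewrite eqn_leq j1.
  rewrite (eq_bigr (fun m => (L + m.+1%:R * d) ^+ 2)) => [|m _];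
    last by rewrite big_nat1.
  rewrite [leRHS](eq_bigr (fun m => (m.+1%:R * d') ^+ 2)) => [|m _]; last first.
    by rewrite big_nat1 addn1 mul0r sub0r sqrrN.
  rewrite -subr_ge0 -sumrB.
  have -> : \sum_(0 <= m < l - 1) ((m.+1%:R * d') ^+ 2 - (L + m.+1%:R * d) ^+ 2)
    = (d + d') * L * (L - 1) * (L - 2) / 6.
    have key N : \sum_(0 <= m < N) ((m.+1%:R * d') ^+ 2 - (L + m.+1%:R * d) ^+
      2)
      = 2 * (d + d') * (N%:R * (N%:R + 1) * (2 * N%:R + 1) / 6)
        + (2 * L - L * (d + d')) * (N%:R * (N%:R + 1) / 2) - L ^+ 2 * N%:R.
      elim: N => [|N IHN]; first by rewrite big_nil; field.
      by rewrite big_nat_recr //= IHN -!natr1 /d' /d; field.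
    by rewrite key natrB -?/L; [field | exact: ltnW].
  have d0 : 0 <= d + d' by rewrite /d /d'; nra.
  have h1 : 0 <= (d + d') * L by apply: mulr_ge0 => //; lra.
  have h2 : 0 <= (L - 1) * (L - 2) by nra.
  have := mulr_ge0 h1 h2; lra.
rewrite big_nat [leRHS]big_nat; apply: ler_sum => m _.
(* Reversing the order of [i] turns the index difference [m + j - i] into [m.+1 + i]. *)
rewrite sumr_const_nat subn0 big_nat_rev /= add0n.
have -> : \sum_(0 <= i < j) ((j - i.+1)%:R * d' - (m + j)%:R * d') ^+ 2 =
    (\sum_(0 <= i < j) (m.+1%:R + i%:R) ^+ 2) * d' ^+ 2.
  rewrite mulr_suml !big_nat; apply: eq_bigr => i /andP[_ ij].
  by rewrite natrB // natrD -!natr1; ring.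
have x0 : 1 <= m.+1%:R :> rat by rewrite ler1n.
have := sum_shift_sqr_ge (le_trans ler01 x0) j_gt1.
move: m.+1%:R x0 => x x1; set S := \sum_(0 <= r < j) _ => hS.
rewrite -mulr_natl.
have hd : 2 * (L + x * d) ^+ 2 <= (2 * x ^+ 2 + 2 * x + 1) * d' ^+ 2.
  (* The estimate [2 * L <= d'] used in the second case holds only from [l = 3] on. *)
  have [l2|l3] := leqP l 2.
    have LE : L = 2 by rewrite /L; congr _%:R; apply/eqP; rewrite eqn_leq l2.
    have -> : d' = 3 by rewrite /d' LE; ring.
    have -> : d = 1 by rewrite /d LE; ring.
    rewrite LE; nra.
  have L3 : 3 <= L by rewrite /L ler_nat.
  have d'L : 2 * L <= d' by rewrite /d'; nra.
  have d0 : 0 <= d by rewrite /d; nra.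
  have dd' : d <= d' by rewrite /d /d'; lra.
  have h1 : 2 * L * d <= d' ^+ 2 by nra.
  have h2 : 2 * x * (2 * L * d) <= 2 * x * d' ^+ 2 by apply: ler_wpM2l => //;
    lra.
  have h3 : (2 * L) ^+ 2 <= d' ^+ 2 by apply: ler_sqr_of_le => //; lra.
  have h4 : x ^+ 2 * d ^+ 2 <= x ^+ 2 * d' ^+ 2.
    by apply: ler_wpM2l; [apply: sqr_ge0 | apply: ler_sqr_of_le].
  have L0 := sqr_ge0 L; nra.
have j0 : 0 <= j%:R :> rat by rewrite ler0n.
have h1 : j%:R * (2 * (L + x * d) ^+ 2) <= j%:R * ((2 * x ^+ 2 + 2 * x + 1) *
  d' ^+ 2).
  by apply: ler_wpM2l.
have h2 : j%:R * (2 * x ^+ 2 + 2 * x + 1) * d' ^+ 2 <= 2 * S * d' ^+ 2.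
  by apply: ler_wpM2r => //; apply: sqr_ge0.
lra.
Qed.

Lemma pair_spread_split (f : nat -> rat) :
  pair_spread l f =
  \sum_(0 <= i < j) \sum_(0 <= i' < j) (f i - f i') ^+ 2 +
  \sum_(j <= i < l) \sum_(j <= i' < l) (f i - f i') ^+ 2 +
  2 * \sum_(0 <= i < j) \sum_(j <= i' < l) (f i - f i') ^+ 2.
Proof.
have split_inner i : \sum_(0 <= i' < l) (f i - f i') ^+ 2 =
    \sum_(0 <= i' < j) (f i - f i') ^+ 2 + \sum_(j <= i' < l) (f i - f i') ^+ 2.
  by rewrite -big_cat_nat.
rewrite /pair_spread (eq_bigr _ (fun i _ =>
  split_inner i)) (big_cat_nat (n := j)) //=.
rewrite !big_split /=.
have -> : \sum_(j <= i < l) \sum_(0 <= i' < j) (f i - f i') ^+ 2 =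
    \sum_(0 <= i < j) \sum_(j <= i' < l) (f i - f i') ^+ 2.
  rewrite exchange_big_nat /=; apply: eq_bigr => i _; apply: eq_bigr => i' _.
  by rewrite -sqrrN opprB.
ring.
Qed.

Lemma pair_spread_le : pair_spread l q <= pair_spread l (fun i => i%:R * d').
Proof.
rewrite !pair_spread_split; apply: lerD; last first.
  by apply: ler_wpM2l; rewrite ?spread_cross_sum.
have sym (i i' : nat) : (i < l)%N -> (i' < l)%N ->
    (maxn i i' < j)%N || (j <= minn i i')%N ->
    (q i - q i') ^+ 2 <= (i%:R * d' - i'%:R * d') ^+ 2.
  move=> il i'l; have [ii'|/ltnW ii'] := leqP i i' => side.
    by apply: spread_term; rewrite ?ii'.
  rewrite -[leLHS]sqrrN -[leRHS]sqrrN !opprB; apply: spread_term;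
    rewrite ?ii' //.
apply: lerD; rewrite big_nat [leRHS]big_nat; apply: ler_sum => i /andP[i1 i2];
  rewrite big_nat [leRHS]big_nat; apply: ler_sum => i' /andP[i'1 i'2];
    apply: sym => //.
- exact: leq_trans i2 j_le.
- exact: leq_trans i'2 j_le.
- by rewrite gtn_max i2 i'2.
- by rewrite leq_min i1 i'1 orbT.
Qed.

End SpreadBound.

(** * The abacus and its first gaps *)

Section Abacus.

Local Open Scope nat_scope.

Variables (l : nat) (b : nat -> nat).
Hypothesis l_prime : prime l.

(* First empty position of runner s when runner s carries b s beads. *)
Definition first_gap (s : nat) : nat := (s + b s * l)%N.
Definition is_bead (x : nat) : bool := (x < first_gap (x %% l))%N.
(** For a bead [x] this is the part that the bead represents. *)
Definition gaps_below (x : nat) : nat := \sum_(0 <= y < x) ~~ is_bead y.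

Let l_gt0 : (0 < l)%N. Proof. exact: prime_gt0. Qed.
Let l_gt1 : (1 < l)%N. Proof. exact: prime_gt1. Qed.

Lemma modn_first_gap s : (s < l)%N -> (first_gap s %% l = s)%N.
Proof. by move=> sl; rewrite /first_gap addnC modnMDl modn_small. Qed.

Lemma gaps_belowS x : gaps_below x.+1 = (gaps_below x + ~~ is_bead x)%N.
Proof. by rewrite /gaps_below big_nat_recr. Qed.

(** The positions from [x] to [x + l - 1] meet each runner once, and runner [s] contributes a gap
    exactly when its first gap is below [x + l]. *)
Lemma gaps_below_period x :
  gaps_below (x + l) =
  (gaps_below x + \sum_(0 <= s < l) (first_gap s < x + l))%N.
Proof.
elim: x => [|x IHx].
  rewrite /gaps_below [in RHS]big_nil !add0n !big_nat.
  apply: eq_bigr => s /andP[_ sl]; rewrite /is_bead modn_small // /first_gap;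
    congr nat_of_bool.
  case: (b s) => [|m]; first by rewrite mul0n addn0 ltnn sl.
  by rewrite mulSn; lia.
rewrite addSn !gaps_belowS IHx.
have -> : \sum_(0 <= s < l) (first_gap s < (x + l).+1) =
   (\sum_(0 <= s < l) (first_gap s < x + l) + (first_gap (x %% l) == x + l))%N.
  have -> : nat_of_bool (first_gap (x %% l) == x + l)%N = \sum_(0 <= s < l)
    (first_gap s == x + l)%N.
    have xl : (x %% l < l)%N by rewrite ltn_mod.
    rewrite (bigD1_seq (x %% l)%N) ?mem_index_iota ?iota_uniq //= big_nat_cond
      big1 ?addn0 //.
    move=> s /andP[/andP[_ sl] sx]; apply/eqP; rewrite eqb0;
      apply: contra sx => /eqP sE.
    by rewrite -(modn_first_gap sl) sE modnDr.
  rewrite -big_split /=; apply: eq_bigr => s _.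
  by rewrite ltnS leq_eqVlt; case: ltngtP.
rewrite /is_bead modnDr -!leqNgt; have := modn_first_gap (ltn_pmod x l_gt0).
move: (first_gap _) => p pE; rewrite addnAC -!addnA; congr (_ + _)%N.
have [px|xp] := leqP p x.
  by have -> : (p <= x + l)%N; [lia | have -> : (p == x + l)%N = false;
    [lia|lia]].
rewrite add0n; suff -> : (p == x + l)%N = (p <= x + l)%N by rewrite addnC.
apply/eqP/idP => [->//|pxl].
have : (l %| p - x)%N by rewrite -eqn_mod_dvd ?pE // ltnW.
move=> /dvdn_leq; rewrite subn_gt0 => /(_ xp); lia.
Qed.

Lemma gaps_below_progression (s t i m : nat) :
  (forall u, (u < m)%N ->
     \sum_(0 <= s' < l) (first_gap s' < s + (t + u).+1 * l) = i) ->
  gaps_below (s + (t + m) * l) = (gaps_below (s + t * l) + m * i)%N.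
Proof.
elim: m => [|m IHm] count_i; first by rewrite addn0 mul0n addn0.
rewrite addnS mulSnr addnA gaps_below_period IHm => [|u um];
  last exact/count_i/ltnW.
by have := count_i m (ltnSn m); rewrite mulSnr addnA => ->;
  rewrite mulSnr addnA.
Qed.

Lemma dvdn_progression (g i : nat) : (0 < i < l)%N ->
  exists2 u, (u < l)%N & (l %| g + u * i)%N.
Proof.
case/andP=> i0 il; have co : coprime l i by rewrite prime_coprime // gtnNdvd.
case: (egcdnP l i0) => km kn kE _; rewrite gcdnC (eqP co) in kE.
(* This is [- g / i] modulo [l]: [km] is the Bezout inverse of [i]. *)
exists (((l - g %% l) * km) %% l)%N; first by rewrite ltn_mod.
rewrite /dvdn -modnDmr modnMml modnDmr -mulnA kE mulnDr muln1 mulnA.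
rewrite addnCA modnMDl -modnDml subnKC ?modnn //.
exact/ltnW/ltn_pmod.
Qed.

Hypothesis no_dvd_part : forall x, is_bead x -> ~~ (l %| gaps_below x)%N.

(** A bead at position 0 would have no gap below it, and [l] divides 0. *)
Lemma first_gap0 : first_gap 0 = 0%N.
Proof.
apply/eqP; rewrite -leqn0 leqNgt; apply/negP=> gap_gt0.
have /no_dvd_part : is_bead 0 by rewrite /is_bead mod0n.
by rewrite /gaps_below big_nil dvdn0.
Qed.

Definition sorted_gaps : seq nat := sort leq [seq first_gap s | s <- iota 0 l].

Local Notation q i := (nth 0%N sorted_gaps i).

Lemma perm_sorted_gaps : perm_eq sorted_gaps [seq first_gap s | s <- iota 0 l].
Proof. by rewrite perm_sort. Qed.

Lemma size_sorted_gaps : size sorted_gaps = l.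
Proof. by rewrite size_sort size_map size_iota. Qed.

Lemma first_gap_inj s s' : (s < l)%N -> (s' < l)%N ->
  first_gap s = first_gap s' %[mod l] -> s = s'.
Proof. by move=> sl s'l; rewrite !modn_first_gap. Qed.

Lemma uniq_sorted_gaps : uniq sorted_gaps.
Proof.
rewrite sort_uniq map_inj_in_uniq ?iota_uniq // => s s';
  rewrite !mem_iota !add0n.
by move=> /= sl s'l eq_ss'; apply: first_gap_inj; rewrite ?eq_ss'.
Qed.

Lemma ltn_sorted_gaps i i' : (i < i')%N -> (i' < l)%N -> (q i < q i')%N.
Proof.
move=> ii' i'l.
have : sorted ltn sorted_gaps
  by rewrite ltn_sorted_uniq_leq uniq_sorted_gaps sort_sorted //;
    exact: leq_total.
move=> /(sorted_ltn_nth ltn_trans 0%N); apply;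
  rewrite ?inE ?size_sorted_gaps //.
exact: ltn_trans ii' i'l.
Qed.

Lemma sorted_gapsP i : (i < l)%N -> exists2 s, (s < l)%N & q i = first_gap s.
Proof.
rewrite -{1}size_sorted_gaps => /(mem_nth 0%N); rewrite mem_sort => /mapP[s].
by rewrite mem_iota => /= sl ->; exists s.
Qed.

Lemma count_sorted_gaps i x : (i < l)%N -> (x <= q i)%N ->
  (forall i', (i' < i)%N -> (q i' < x)%N) ->
  \sum_(0 <= s < l) (first_gap s < x) = i.
Proof.
move=> il xi ix.
transitivity (\sum_(y <- sorted_gaps) (y < x))%N.
  by rewrite (perm_big _ perm_sorted_gaps) big_map /index_iota subn0.
rewrite (big_nth 0%N) size_sorted_gaps (big_cat_nat (leq0n i) (ltnW il)).
transitivity (i + 0)%N; last by rewrite addn0.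
congr addn.
  rewrite big_nat (eq_bigr (fun=> 1%N)) => [|i' /andP[_ i'i]];
    last by rewrite ix.
  by rewrite -big_nat sum_nat_const_nat muln1 subn0.
rewrite big_nat big1 // => i' /andP[ii' i'l].
apply/eqP; rewrite eqb0 -leqNgt (leq_trans xi) //.
move: ii'; rewrite leq_eqVlt => /orP[/eqP->//|ii'].
exact/ltnW/ltn_sorted_gaps.
Qed.

(** Let [q i.+1] be the first gap of runner [s]. With fewer than [l] beads there, it is below
    [l ^ 2]. Otherwise, if the step were too long, exactly [i.+1] runners would be exhausted along
    the last [l] beads, whose parts would form a progression of difference [i.+1] and include a
    multiple of [l]. *)
Lemma sorted_gaps_step i : (i.+1 < l)%N ->
  (q i.+1 < l ^ 2)%N || (q i.+1 + l < q i + l ^ 2)%N.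
Proof.
move=> il; have [s sl qs] := sorted_gapsP il.
have [s' s'l qs'] := sorted_gapsP (ltnW il).
have lt_q := ltn_sorted_gaps (ltnSn i) il.
have [bl|lb] := ltnP (b s) l.
  by apply/orP; left; rewrite qs /first_gap; nia.
rewrite -implyNb; apply/implyP => _; rewrite ltn_neqAle; apply/andP; split.
  (* Equality would make [q i.+1] and [q i] congruent modulo [l], hence first gaps of the same
     runner. *)
  apply: contraTneq lt_q => qE; rewrite -leqNgt.
  have ss' : s = s'.
    apply: first_gap_inj => //; rewrite -qs -qs' -(modnDr (q i.+1)) qE.
    by rewrite -mulnn addnC modnMDl.
  by rewrite qs qs' ss'.
rewrite leqNgt; apply/negP=> big.
have count_i u : (u < l.-1)%N ->
    \sum_(0 <= s0 < l) (first_gap s0 < s + ((b s - l) + u).+1 * l) = i.+1.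
  move=> ul; apply: count_sorted_gaps => //; first by rewrite qs /first_gap;
    nia.
  move=> i'; rewrite ltnS => i'i; have : (q i' <= q i)%N.
    by move: i'i; rewrite leq_eqVlt => /orP[/eqP->//|i'i];
      apply/ltnW/ltn_sorted_gaps/ltnW.
  move: big; rewrite qs /first_gap; nia.
have [u ul dvd_u] := @dvdn_progression (gaps_below (s + (b s - l) * l)) i.+1 il.
have gE : gaps_below (s + (b s - l + u) * l) =
    (gaps_below (s + (b s - l) * l) + u * i.+1)%N.
  apply: gaps_below_progression => v vu; apply: count_i; lia.
have /no_dvd_part : is_bead (s + (b s - l + u) * l).
  by rewrite /is_bead addnC modnMDl modn_small // /first_gap; nia.
by rewrite gE dvd_u.
Qed.

Lemma sorted_gaps0 : q 0 = 0.
Proof.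
have : 0 \in sorted_gaps.
  rewrite mem_sort; apply/mapP; exists 0; first by rewrite mem_iota.
  by rewrite first_gap0.
case/(nthP 0) => -[//|i]; rewrite size_sorted_gaps => il qi.
by have := ltn_sorted_gaps (ltn0Sn i) il; rewrite qi.
Qed.

Local Open Scope ring_scope.

Lemma sum_sorted_gaps (F : nat -> rat) :
  \sum_(0 <= i < l) F (q i) = \sum_(0 <= s < l) F (first_gap s).
Proof.
transitivity (\sum_(y <- sorted_gaps) F y).
  by rewrite [RHS](big_nth 0%N) size_sorted_gaps.
by rewrite (perm_big _ perm_sorted_gaps) big_map /index_iota subn0.
Qed.

Lemma spread_sorted_gaps_le :
  pair_spread l (fun i => (q i)%:R) <=
  pair_spread l (fun i => i%:R * (l%:R ^+ 2 - l%:R + 1)).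
Proof.
(* [j] is the number of empty runners, whose first gaps are the values below [l]. *)
have ex_j : exists j, (j == l) || (l <= q j)%N by exists l; rewrite eqxx.
case: (ex_minnP ex_j) => j jP j_min {ex_j}.
have jl : (j <= l)%N by apply: j_min; rewrite eqxx.
have lowq i : (i < j)%N -> (q i < l)%N.
  move=> ij; rewrite ltnNge; apply: contraTN ij => li; rewrite -leqNgt.
  by apply: j_min; rewrite li orbT.
have highq : (j < l)%N -> (l <= q j)%N.
  by move=> lt_jl; case/orP: jP => // /eqP jE; rewrite jE ltnn in lt_jl.
have j_gt0 : (0 < j)%N.
  rewrite lt0n; apply: contraTneq jP => ->;
    rewrite sorted_gaps0 negb_or -ltnNge l_gt0.
  by rewrite eq_sym -lt0n l_gt0.
have leq_q i i' : (i <= i')%N -> (i' < l)%N -> (q i <= q i')%N.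
  by rewrite leq_eqVlt => /orP[/eqP->//|ii' i'l]; apply/ltnW/ltn_sorted_gaps.
apply: (pair_spread_le l_gt1 j_gt0 jl).
- by move=> i /lowq ql; rewrite ler0n /= lerBrDr natr1 ler_nat.
- by move=> i i' /andP[ii' i'l]; rewrite ler_nat leq_q.
- move=> lt_jl; case: j j_gt0 lt_jl lowq {jP j_min jl highq} => // j _ jl lowq.
  have := lowq j (ltnSn j); have := sorted_gaps_step jl.
  rewrite lerBrDr natr1 -natrX ler_nat; lia.
move=> i ji il; have := sorted_gaps_step il.
have : (l <= q i)%N.
  by apply: leq_trans (highq _) (leq_q _ _ ji (ltnW il));
    apply: leq_ltn_trans ji (ltnW il).
(* Since [l <= q i], the alternative [q i.+1 < l ^ 2] yields the same bound. *)
move=> lq step; suff : (q i.+1 + l + 1 <= q i + l ^ 2)%N.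
  rewrite -(ler_nat rat) !natrD natrX; lra.
move: step; nia.
Qed.

(** The hypothesis makes the spread of the first gaps equal to [4 * l ^ 2 * n] plus the spread of
    [0, ..., l - 1], so a bound on the spread is a bound on [n]. *)
Lemma abacus_size_le (n : nat) :
  n%:R *+ 2 = \sum_(0 <= s < l)
      (2 * s%:R * (b s)%:R + l%:R * (b s)%:R ^+ 2 - l%:R * (b s)%:R)
    + \sum_(0 <= s < l) (b s)%:R - (\sum_(0 <= s < l) (b s)%:R) ^+ 2 :> rat ->
  n%:R <= core_bound l.
Proof.
set L : rat := l%:R; set K := \sum_(0 <= s < l) (b s)%:R => nE.
have L0 : 0 < L by rewrite ltr0n.
pose d' := L ^+ 2 - L + 1.
have := spread_sorted_gaps_le; rewrite pair_spread_scale -/L pair_spreadE.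
rewrite (sum_sorted_gaps (fun x => x%:R)) (sum_sorted_gaps (fun x =>
  x%:R ^+ 2)).
pose X := \sum_(0 <= s < l) s%:R * (b s)%:R : rat.
pose Y := \sum_(0 <= s < l) (b s)%:R ^+ 2 : rat.
have -> : \sum_(0 <= s < l) (first_gap s)%:R = L * (L - 1) / 2 + L * K.
  rewrite -sum_id_rat mulr_sumr -big_split /=; apply: eq_bigr => s _.
  by rewrite natrD natrM mulrC.
have -> : \sum_(0 <= s < l) (first_gap s)%:R ^+ 2 =
    L * (L - 1) * (2 * L - 1) / 6 + 2 * L * X + L ^+ 2 * Y.
  rewrite -sum_sqr_rat !mulr_sumr -!big_split /=; apply: eq_bigr => s _.
  by rewrite natrD natrM -/L; ring.
have {}nE : n%:R *+ 2 = 2 * X + L * Y - L * K + K - K ^+ 2.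
  rewrite nE; congr (_ + _ - _); rewrite !mulr_sumr -sumrN -!big_split /=.
  by apply: eq_bigr => s _; ring.
rewrite -/L => le_spread.
suff : L ^+ 2 * (24 * n%:R) <= L ^+ 2 * (24 * core_bound l).
  by rewrite ler_pM2l ?exprn_gt0 // ler_pM2l.
have -> : L ^+ 2 * (24 * core_bound l) = L ^+ 2 * ((L ^+ 2 - 1) * (d' ^+ 2 -
  1)).
  by rewrite /core_bound -/L /d'; field.
have -> : L ^+ 2 * (24 * n%:R) = 12 * L ^+ 2 * (n%:R *+ 2) by ring.
by rewrite nE; move: le_spread; rewrite -/d'; lra.
Qed.

End Abacus.

(** * The abacus of a core *)

Section CoreAbacus.

Local Open Scope nat_scope.

Variables (l n : nat) (mu : seq nat).
Hypothesis l_prime : prime l.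
Hypothesis mu_part : is_partition n mu.
Hypothesis mu_core : is_core l mu.

Let k := size mu.
Let l_gt0 : 0 < l. Proof. exact: prime_gt0. Qed.
Let smu : sorted geq mu. Proof. by case/and3P: mu_part. Qed.

(** For [i < k] this is the hook length of the first cell of row [i]; these are the beta-numbers of
    [mu]. *)
Definition beta (i : nat) : nat := nth 0 mu i + (k - i.+1).
Definition beads : seq nat := mkseq beta k.

Lemma ltn_beta i i' : i < i' -> i' < k -> beta i' < beta i.
Proof.
move=> ii' i'k; have := leq_nth_sorted_geq smu (ltnW ii').
rewrite /beta; lia.
Qed.

Lemma beta_inj i i' : i < k -> i' < k -> beta i = beta i' -> i = i'.
Proof.
move=> ik i'k eq_b; case: (ltngtP i i') => // lt_i.
  by have := ltn_beta lt_i i'k; rewrite eq_b ltnn.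
by have := ltn_beta lt_i ik; rewrite eq_b ltnn.
Qed.

Lemma uniq_beads : uniq beads.
Proof.
rewrite map_inj_in_uniq ?iota_uniq // => i i'; rewrite !mem_iota !add0n.
exact: beta_inj.
Qed.

Lemma beadsP x : reflect (exists2 i, i < k & x = beta i) (x \in beads).
Proof.
apply: (iffP mapP) => -[i]; rewrite ?mem_iota => ik ->; first by exists i.
by exists i; rewrite ?mem_iota.
Qed.

(* An empty position l below a bead would give a cell of hook length l. *)
Lemma beads_flush x : x + l \in beads -> x \in beads.
Proof.
case/beadsP=> i ik xE; apply: contraT => xB.
(* [t] counts the beads above [x], as beads are listed in decreasing order. *)
pose t := find (fun y => y <= x) beads.
have szB : size beads = k by rewrite size_mkseq.
have nthB r : r < k -> nth 0 beads r = beta r by move=> rk; rewrite nth_mkseq.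
have tk : t <= k by rewrite -szB find_size.
have before r : r < t -> x < beta r.
  move=> rt; have := before_find 0 rt; rewrite nthB ?(leq_trans rt) // leqNgt.
  by move/negbFE.
have after : t < k -> beta t < x.
  move=> lt_tk; rewrite ltn_neqAle; apply/andP; split.
    by apply: contraNneq xB => <-; apply/beadsP; exists t.
  have := @nth_find _ 0 (fun y => y <= x) beads.
  by rewrite has_find szB -/t lt_tk nthB // => ->.
have it : i < t.
  rewrite ltnNge; apply/negP=> ti; have lt_tk := leq_ltn_trans ti ik.
  have := after lt_tk; have : beta i <= beta t.
    by move: ti; rewrite leq_eqVlt => /orP[/eqP->//|ti]; apply/ltnW/ltn_beta.
  lia.
(* There are [k - t] beads below [x], so [j] counts the empty positions below [x]. Column [j] has
   length [t], and cell [(i, j)] has hook length [beta i - x = l]. *)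
pose j := x + t - k.
have tj : k <= x + t.
  have [lt_tk|] := ltnP t k; last lia.
  by have := after lt_tk; rewrite /beta; lia.
have jt r : r < t -> j < nth 0 mu r.
  move=> rt; have t0 : t.-1 < t by lia.
  have := before _ t0; have := @leq_nth_sorted_geq mu r t.-1 smu.
  rewrite /beta /j; lia.
have tj' : nth 0 mu t <= j.
  have [lt_tk|kt] := ltnP t k; last by rewrite nth_default.
  by have := after lt_tk; rewrite /beta /j; lia.
have colE : column_length mu j = t.
  apply/eqP; rewrite eqn_leq; apply/andP; split.
    by rewrite leqNgt ltn_column_length // -leqNgt.
  case: (t) jt => // t' jt; rewrite ltn_column_length // jt //.
have := mu_core ik (jt i it); have -> : hook_length mu i j = l.
  have := jt i it; rewrite /hook_length colE; move: xE; rewrite /beta /j; lia.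
by rewrite dvdnn.
Qed.

(** By [beads_flush] the beads of a runner form an initial segment, which ends because there are
    finitely many beads. *)
Lemma runner_threshold s : {m | forall t, (s + t * l \in beads) = (t < m)}.
Proof.
have ex : exists t, s + t * l \notin beads.
  pose M := \max_(x <- beads) x; exists M.+1; apply/negP=> inB.
  have : s + M.+1 * l <= M by apply: (leq_bigmax_seq (F := id)).
  nia.
case: (ex_minnP ex) => m mB m_min; exists m => t; apply/idP/idP => [tB|tm].
  rewrite ltnNge; apply: contraNN mB => mt.
  rewrite -(subnK mt) in tB; elim: (t - m) tB => // r IHr.
  by rewrite addSn mulSn [l + _]addnC addnA => /beads_flush.
by apply: contraTT tm => /m_min; rewrite -leqNgt.
Qed.

Let b s := sval (runner_threshold s).

Lemma beads_abacus x : (x \in beads) = is_bead l b x.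
Proof.
have xE : x %% l + x %/ l * l = x by rewrite addnC -divn_eq.
rewrite -{1}xE (svalP (runner_threshold _)) -/(b _) /is_bead /first_gap.
by rewrite -{3}xE ltn_add2l ltn_pmul2r.
Qed.

(** Among the [beta i] positions below bead [i], exactly [k - i.+1] carry beads, namely the later
    ones. *)
Lemma gaps_below_beta i : i < k -> gaps_below l b (beta i) = nth 0 mu i.
Proof.
move=> ik; pose x := beta i.
have tot : gaps_below l b x + count (fun y => y < x) beads = x.
  have -> : count (fun y => y < x) beads = \sum_(0 <= y < x) (y \in beads).
    rewrite -size_filter.
    have -> : \sum_(0 <= y < x) (y \in beads) = size [seq y <- iota 0 x | y \in
      beads].
      by rewrite size_filter -sum1_count /index_iota subn0 [RHS]big_mkcond;
         apply: eq_bigr => y _; case: (y \in beads).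
    apply/perm_size/uniq_perm; rewrite ?filter_uniq ?iota_uniq ?uniq_beads //.
    by move=> y; rewrite !mem_filter mem_iota andbC.
  rewrite /gaps_below -big_split /= (eq_bigr (fun=> 1)) => [|y _].
    by rewrite sum_nat_const_nat subn0 muln1.
  by rewrite beads_abacus; case: is_bead.
have cnt : count (fun y => y < x) beads = k - i.+1.
  rewrite count_map -{1}(subnKC ik) iotaD count_cat add0n.
  have -> : count (preim beta (fun y => y < x)) (iota 0 i.+1) = 0.
    apply/eqP; rewrite -leqn0 leqNgt -has_count; apply/hasPn => r;
      rewrite mem_iota.
    rewrite add0n ltnS /= => ri; rewrite -leqNgt /x.
    by move: ri; rewrite leq_eqVlt => /orP[/eqP->//|ri]; apply/ltnW/ltn_beta.
  rewrite add0n; transitivity (size (iota i.+1 (k - i.+1)));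
    last by rewrite size_iota.
  apply/eqP; rewrite -all_count; apply/allP => r; rewrite mem_iota subnKC //.
  by move=> /andP[ir rk]; apply: ltn_beta.
by move: tot; rewrite cnt /x /beta; lia.
Qed.

Local Open Scope ring_scope.

Lemma big_beads (F : nat -> rat) :
  \sum_(x <- beads) F x = \sum_(0 <= i < k) F (beta i).
Proof. by rewrite /beads /mkseq big_map /index_iota subn0. Qed.

Lemma sum_beads (F : nat -> rat) :
  \sum_(x <- beads) F x = \sum_(0 <= s < l) \sum_(0 <= t < b s) F (s + t * l)%N.
Proof.
pose B' := [seq (s + t * l)%N | s <- iota 0 l, t <- iota 0 (b s)].
have modE s t : (s < l)%N -> ((s + t * l) %% l = s)%N.
  by move=> sl; rewrite addnC modnMDl modn_small.
have perm : perm_eq beads B'.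
  apply: uniq_perm; first exact: uniq_beads.
    apply: allpairs_uniq_dep => [|s _|]; rewrite ?iota_uniq //.
    move=> _ _ /allpairsPdep[s [t [sl tb ->]]] /allpairsPdep[s' [t' [s'l tb'
      ->]]] /= eq_x.
    move: sl s'l; rewrite !mem_iota !add0n => /= sl s'l.
    have ss' : s = s' by rewrite -(modE s t sl) eq_x modE.
    move: eq_x; rewrite ss' => /addnI/eqP; rewrite eqn_pmul2r // => /eqP->.
    by [].
  move=> x; rewrite beads_abacus /is_bead /first_gap; apply/idP/allpairsPdep.
    move=> xb; exists (x %% l)%N, (x %/ l)%N;
      rewrite !mem_iota !add0n ltn_mod l_gt0.
    split=> //; last by rewrite addnC -divn_eq.
    by move: xb;
      rewrite {1}(divn_eq x l) [X in (X < _)%N]addnC ltn_add2l ltn_pmul2r.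
  move=> [s [t [sl tb ->]]]; move: sl tb; rewrite !mem_iota !add0n => /= sl tb.
  by rewrite modE // ltn_add2l ltn_pmul2r.
rewrite (perm_big _ perm) big_allpairs_dep /=.
by rewrite /index_iota !subn0; apply: eq_bigr => s _; rewrite subn0.
Qed.

(** The beta-numbers add up to [n + k * (k - 1) / 2]; on each runner they form a progression of
    difference [l], which expresses [n] through the [b s]. *)
Lemma core_size_abacus :
  n%:R *+ 2 = \sum_(0 <= s < l)
      (2 * s%:R * (b s)%:R + l%:R * (b s)%:R ^+ 2 - l%:R * (b s)%:R)
    + \sum_(0 <= s < l) (b s)%:R - (\sum_(0 <= s < l) (b s)%:R) ^+ 2 :> rat.
Proof.
have -> : \sum_(0 <= s < l) (b s)%:R = k%:R :> rat.
  have := sum_beads (fun=> 1); rewrite big_beads sumr_const_nat subn0 => ->.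
  by apply: eq_bigr => s _; rewrite sumr_const_nat subn0.
have -> : \sum_(0 <= s < l)
      (2 * s%:R * (b s)%:R + l%:R * (b s)%:R ^+ 2 - l%:R * (b s)%:R)
    = 2 * \sum_(x <- beads) x%:R :> rat.
  rewrite (sum_beads (fun x => x%:R)) mulr_sumr; apply: eq_bigr => s _.
  elim: (b s) => [|m IHm]; first by rewrite big_nil; ring.
  rewrite big_nat_recr //= mulrDr -IHm natrD natrM -natr1; ring.
have -> : \sum_(x <- beads) x%:R = n%:R + k%:R * (k%:R - 1) / 2 :> rat.
  have nE : n%:R = \sum_(0 <= i < k) (nth 0%N mu i)%:R :> rat.
    case/and3P: mu_part => _ _ /eqP <-; rewrite sumnE natr_sum (big_nth 0%N).
    by [].
  rewrite big_beads -sum_id_rat nE [X in _ + X]big_nat_rev -big_split /=.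
  by rewrite !big_nat; apply: eq_bigr => i _; rewrite /beta natrD.
by field.
Qed.

Lemma core_has_dvd_part : core_bound l < n%:R -> exists2 r, r \in mu & (l %|
  r)%N.
Proof.
move=> nbig.
have [/hasP[r]|/hasPn no_dvd] := boolP (has (fun r => l %| r)%N mu);
  first by exists r.
have /abacus_size_le le_n := core_size_abacus; exfalso; move: nbig; apply/negP.
rewrite -leNgt; apply: le_n => // x; rewrite -beads_abacus => /beadsP[i ik ->].
by rewrite gaps_below_beta // no_dvd // mem_nth.
Qed.

End CoreAbacus.

Unset Implicit Arguments.

Theorem theorem1p3 (l n : nat) (la mu : seq nat) :
  prime l ->
  core_bound l < n%:R ->
  is_partition n la -> is_partition n mu ->
  is_core l la -> is_core l mu ->
  forall g : 'S_n, cycle_type g = mu -> specht_char n la g = 0.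
Proof.
move=> l_prime n_big la_part mu_part la_core mu_core g g_mu.
apply: (specht_char_core_singular la_part l_prime la_core).
have [r] := core_has_dvd_part l_prime mu_part mu_core n_big.
(* A part of [mu] is the size of a cycle of [g], which divides the order of [g]. *)
rewrite -g_mu mem_sort => /mapP[X];
  rewrite mem_enum => /imsetP[x _ ->] -> l_dvd.
exact: dvdn_trans l_dvd (card_porbit_dvd g x).
Qed.
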